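(* For every $d\in\mathbb{N}$ and $q\in(-1,1)$ there exists a compactly supported probability measure $\nu_{d;q}$ on $\mathbb{R}$ such that $$\int_{\mathbb{R}}x^n\,d\nu_{d;q}(x)=\widetilde{Q}_n(d,q),\qquad\forall\,n\in\mathbb{N}.$$ Moreover, $\nu_{d;q}$ can be taken to be the distribution, with respect to the vacuum-state $\varphi_{\mathrm{vac}}$ on the $q$-Fock space $\mathcal{T}_{d;q}$, of the selfadjoint operator $T_{d;q}=\sum_{i=1}^d (L_{i;q}+L_{i;q}^* )(R_{i;q}+R_{i;q}^* )\in B(\mathcal{T}_{d;q})$.
   Context: $\mathbb{N}=\{1,2,3,\dots\}$; inner products are linear in the first variable; $0^0=1$. The distribution of a bounded selfadjoint operator $T$ with respect to a state $\varphi$ is the unique compactly supported probability measure $\nu$ on $\mathbb{R}$ with $\int x^n d\nu=\varphi(T^n)$ for all $n\in\mathbb{N}$ (scalar spectral measure). $q$-Fock space. For $n\in\mathbb{N}$, equip $(\mathbb{C}^d)^{\otimes n}$ with the inner product determined by $\langle v_1\otimes\cdots\otimes v_n, w_1\otimes\cdots\otimes w_n\rangle_q=\sum_{\tau\in S_n} q^{\iota(\tau)}\prod_{i=1}^n\langle v_i,w_{\tau(i)}\rangle$, where $\iota(\tau)=|\{(i,j): 1\le i<j\le n,\ \tau(i)>\tau(j)\}|$ (this is known to be an inner product). $\mathcal{T}_{d;q}$ is the Hilbert space orthogonal direct sum $\mathbb{C}\oplus\bigoplus_{n\ge1}(\mathbb{C}^d)^{\otimes n}$; the vector $1\in\mathbb{C}$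 is the vacuum vector $\xi_{\mathrm{vac}}$, and $\varphi_{\mathrm{vac}}(X)=\langle X\xi_{\mathrm{vac}},\xi_{\mathrm{vac}}\rangle$ for $X\in B(\mathcal{T}_{d;q})$. For $v\in\mathbb{C}^d$, $L(v),R(v)\in B(\mathcal{T}_{d;q})$ are the (bounded) operators determined by $L(v)\xi_{\mathrm{vac}}=v=R(v)\xi_{\mathrm{vac}}$, $L(v)(v_1\otimes\cdots\otimes v_n)=v\otimes v_1\otimes\cdots\otimes v_n$, $R(v)(v_1\otimes\cdots\otimes v_n)=v_1\otimes\cdots\otimes v_n\otimes v$. With $e_1,\dots,e_d$ the standard orthonormal basis of $\mathbb{C}^d$, put $L_{i;q}=L(e_i)$, $R_{i;q}=R(e_i)$; $^*$ denotes the adjoint. Polynomials. $\mathcal{P}_2(2n)$ is the set of pair-partitions of $\{1,\dots,2n\}$ (partitions into $n$ blocks of size 2). Two distinct blocks of $\pi\in\mathcal{P}_2(2n)$ cross if, writing their union as $\{a<b<c<d\}$, one block is $\{a,c\}$ and the other $\{b,d\}$; $\mathrm{cr}(\pi)$ is the number of unordered pairs of crossing blocks. $\rho_{2n}=\{\{1,2n\},\{2,2n-1\},\dots,\{n,n+1\}\}$ is the rainbow pair-partition. $\pi\vee\sigma$ is the join in the lattice of all partitions of $\{1,\dots,2n\}$ under reverse refinement order (the finest partition of which both $\pi,\sigma$ are refinements), and $|\cdot|$ is the number of blocks. A self-intersecting meandric system of order $n$ is a pair $(\pi,\sigma)$ in $\mathcal{P}_2(2n)^2$ ($\pi$ drawn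 above and $\sigma$ below a horizontal line); its number of crossings is $\mathrm{cr}(\pi)+\mathrm{cr}(\sigma)$ and its number of closed curves is $|\pi\vee\sigma|$. Let $r_n^{(k,\ell)}$ be the number of such systems with $\sigma=\rho_{2n}$ having exactly $k$ closed curves and $\ell$ crossings, and $\widetilde{Q}_n(t,u)=\sum_{k=1}^n\sum_{\ell=0}^{n^2-n} r_n^{(k,\ell)}t^ku^\ell$. Equivalently, $\widetilde{Q}_n(t,u)=\sum_{\pi\in\mathcal{P}_2(2n)}t^{|\pi\vee\rho_{2n}|}u^{\mathrm{cr}(\pi)}$. *)

(* Defs.v *)
From HB Require Import structures.
From mathcomp Require Import all_boot all_order all_algebra all_fingroup.
From mathcomp Require Import complex.

Set Implicit Arguments.
Unset Strict Implicit.
Unset Printing Implicit Defensive.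

Import Order.TTheory GRing.Theory Num.Theory.

(* The points 1, ..., m of the horizontal line are encoded as 0, ..., m - 1. *)
Section PairPartitions.

Definition pair_partitions (m : nat) : {set {set {set 'I_m}}} :=
  [set P : {set {set 'I_m}} |
    partition P [set: 'I_m] & [forall B in P, #|B| == 2]]%SET.

Definition blocks_cross (m : nat) (V W : {set 'I_m}) : bool :=
  [exists a : 'I_m, exists b : 'I_m, exists c : 'I_m, exists e : 'I_m,
    [&& (a < b)%N, (b < c)%N, (c < e)%N &
      ((V == [set a; c]) && (W == [set b; e])) ||
      ((W == [set a; c]) && (V == [set b; e]))]]%SET.

Definition crossings (m : nat) (P : {set {set 'I_m}}) : nat :=
  #|[set [set V; W] | V in P, W in P & blocks_cross V W]%SET|.

(* i is matched with 2n - 1 - i; each block is listed twice in this image set *)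
Definition rainbow (n : nat) : {set {set 'I_(2 * n)}} :=
  [set [set i; rev_ord i] | i : 'I_(2 * n)]%SET.

Definition refines (m : nat) (P S : {set {set 'I_m}}) : bool :=
  [forall V in P, exists W in S, V \subset W].

Definition is_join (m : nat) (P S J : {set {set 'I_m}}) : bool :=
  [&& partition J [set: 'I_m]%SET, refines P J, refines S J &
    [forall K : {set {set 'I_m}},
      [&& partition K [set: 'I_m]%SET, refines P K & refines S K]
        ==> refines J K]].

(* The default is never used on partitions: see [partition_joinP]. *)
Definition partition_join (m : nat) (P S : {set {set 'I_m}}) :
    {set {set 'I_m}} :=
  odflt set0 [pick J | is_join P S J].

Definition meandric_systems (n : nat) :
    {set {set {set 'I_(2 * n)}} * {set {set 'I_(2 * n)}}} :=
  setX (pair_partitions (2 * n)) (pair_partitions (2 * n)).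

Definition system_curves (n : nat)
    (M : {set {set 'I_(2 * n)}} * {set {set 'I_(2 * n)}}) : nat :=
  #|partition_join M.1 M.2|.

Definition system_crossings (n : nat)
    (M : {set {set 'I_(2 * n)}} * {set {set 'I_(2 * n)}}) : nat :=
  (crossings M.1 + crossings M.2)%N.

Definition rainbow_count (n k l : nat) : nat :=
  #|[set M in meandric_systems n |
      [&& M.2 == rainbow n, system_curves M == k & system_crossings M == l]]%SET|.

Local Open Scope ring_scope.

Definition Qtilde (A : pzSemiRingType) (n : nat) (t u : A) : A :=
  \sum_(1 <= k < n.+1) \sum_(0 <= l < (n ^ 2 - n).+1)
    (rainbow_count n k l)%:R * t ^+ k * u ^+ l.

Lemma partition_joinP (m : nat) (P S : {set {set 'I_m}}) :
  partition P [set: 'I_m]%SET -> partition S [set: 'I_m]%SET ->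
  is_join P S (partition_join P S).
Proof.
move=> pP pS; rewrite /partition_join; case: pickP => //= noJ; exfalso.
pose e := [rel x y : 'I_m | (pblock P x == pblock P y) || (pblock S x == pblock S y)].
have e_sym : connect_sym e.
  by apply: sym_connect_sym => x y; rewrite /= ![_ == pblock _ y]eq_sym.
pose J := equivalence_partition (connect e) [set: 'I_m]%SET.
have eqvJ : {in [set: 'I_m]%SET & &, equivalence_rel (connect e)}.
  move=> x y z _ _ _; split; first exact: connect0.
  by move=> xy; apply: (same_connect e_sym xy).
have pJ : partition J [set: 'I_m]%SET by apply: equivalence_partitionP.
have inJ x : [set y | connect e x y]%SET \in J.
  by apply/imsetP; exists x => //; apply/setP => y; rewrite !inE.
have ref1 Q : partition Q [set: 'I_m]%SET ->
    (forall x y, pblock Q x == pblock Q y -> e x y) -> refines Q J.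
  move=> /and3P[_ tQ nQ] sub; apply/forall_inP => V VQ.
  have /set0Pn[x xV] : V != set0 by apply: contraNneq nQ => <-.
  apply/exists_inP; exists [set y | connect e x y]%SET => //.
  apply/subsetP => y yV; rewrite inE; apply/connect1/sub.
  by rewrite !(def_pblock tQ VQ).
have := noJ J; rewrite /is_join pJ (ref1 P) ?(ref1 S) //=; last 2 first.
- by move=> x y /= ->; rewrite orbT.
- by move=> x y /= ->.
move=> /negbT/negP; apply; apply/forallP => K; apply/implyP => /and3P[pK PK SK].
have [/eqP cK tK _] := and3P pK.
have refE Q x y : partition Q [set: 'I_m]%SET -> refines Q K ->
    pblock Q x == pblock Q y -> pblock K x = pblock K y.
  move=> /and3P[/eqP cQ tQ _] /forall_inP QK /eqP xy.
  have mQ z : z \in cover Q by rewrite cQ inE.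
  have /exists_inP[W WK sub] := QK _ (pblock_mem (mQ x)).
  have xW : x \in W by apply: (subsetP sub); rewrite mem_pblock.
  have yW : y \in W by apply: (subsetP sub); rewrite xy mem_pblock.
  by rewrite (def_pblock tK WK xW) (def_pblock tK WK yW).
apply/forall_inP => V /imsetP[x _ ->]; apply/exists_inP.
have mK z : z \in cover K by rewrite cK inE.
exists (pblock K x); first exact: pblock_mem.
apply/subsetP => y; rewrite !inE /= => /connectP[p pth ->].
elim: p x pth => [|z p IHp] x /=; first by rewrite mem_pblock.
move=> /andP[exz /IHp]; suff -> : pblock K x = pblock K z by [].
by case/orP: exz; apply: refE.
Qed.

End PairPartitions.

From mathcomp Require Import all_classical all_reals all_analysis.
Import numFieldNormedType.Exports.

Local Open Scope classical_set_scope.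
Local Open Scope ring_scope.
Local Open Scope complex_scope.

(* A vector of the full algebraic direct product of the spaces (C^d)^{(x) n}
   is encoded by its coordinates in the basis e_{w_1} (x) ... (x) e_{w_n}, where
   w runs over all words on {0, ..., d - 1}; the words of length n carry the
   component in (C^d)^{(x) n}, and the empty word carries the component in C. *)
Definition qvec (R : realType) (d : nat) := seq 'I_d -> R[i].

Section QFock.
Variables (R : realType) (d : nat) (q : R).

Local Notation C := R[i].
Local Notation V := (qvec R d).

Definition ebasis (i : 'I_d) : 'rV[C]_d := delta_mx 0 i.

Definition hdot (v w : 'rV[C]_d) : C := \sum_(i < d) v 0 i * (w 0 i)^*.

Definition inversions (n : nat) (s : 'S_n) : nat :=
  #|[set p : 'I_n * 'I_n | (p.1 < p.2)%N && (s p.2 < s p.1)%N]%SET|.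

(* the inner product of the components of degree n, expanded sesquilinearly
   in the basis of elementary tensors; see [level_inner_tensor] *)
Definition level_inner (n : nat) (x y : V) : C :=
  \sum_(s : n.-tuple 'I_d) \sum_(t : n.-tuple 'I_d) x s * (y t)^* *
    \sum_(u : 'S_n) q%:C ^+ inversions u *
      \prod_(i < n) hdot (ebasis (tnth s i)) (ebasis (tnth t (u i))).

(* The Hilbert space orthogonal direct sum: since every summand is finite
   dimensional, it consists of the square-summable families. *)
Definition qfock : set V :=
  [set x | cvgn (series (fun n => complex.Re (level_inner n x x)))].

(* the sum over n of [level_inner n x y], computed componentwise in C *)
Definition qinner (x y : V) : C :=
  limn (series (fun n => complex.Re (level_inner n x y))) +i*
  limn (series (fun n => complex.Im (level_inner n x y))).

Definition qnorm (x : V) : R := Num.sqrt (complex.Re (qinner x x)).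

(* An operator on the q-Fock space is represented by a map on [V]; only its
   values on [qfock] are meaningful. *)
Definition bounded_operator (A : V -> V) : Prop :=
  [/\ forall x, qfock x -> qfock (A x),
      forall (a : C) (x y : V), qfock x -> qfock y ->
        A (a *: x + y) = a *: A x + A y &
      exists M : R, forall x, qfock x -> qnorm (A x) <= M * qnorm x].

Definition is_adjoint (A B : V -> V) : Prop :=
  forall x y, qfock x -> qfock y -> qinner (A x) y = qinner x (B y).

(* A bounded adjoint is unique as a map on [qfock], so the choice made by [xget]
   only affects irrelevant values; a bounded operator always has one. *)
Definition adjoint (A : V -> V) : V -> V :=
  xget (fun=> 0) [set B | bounded_operator B /\ is_adjoint A B].

Definition selfadjoint (A : V -> V) : Prop := is_adjoint A A.

Definition vacuum : V := fun w => (w == [::])%:R.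

Definition vacuum_state (A : V -> V) : C := qinner (A vacuum) vacuum.

(* [tensor [:: v_1; ...; v_n]] is v_1 (x) ... (x) v_n *)
Definition tensor (vs : seq 'rV[C]_d) : V := fun w =>
  if size vs == size w then \prod_(p <- zip vs w) p.1 0 p.2 else 0.

Definition Lop (v : 'rV[C]_d) (x : V) : V := fun w =>
  if w is i :: w' then v 0 i * x w' else 0.

(* [belast i w'] and [last i w'] are the word [i :: w'] without its last letter,
   and its last letter *)
Definition Rop (v : 'rV[C]_d) (x : V) : V := fun w =>
  if w is i :: w' then x (belast i w') * v 0 (last i w') else 0.

Definition Lsum (i : 'I_d) : V -> V :=
  Lop (ebasis i) \+ adjoint (Lop (ebasis i)).

Definition Rsum (i : 'I_d) : V -> V :=
  Rop (ebasis i) \+ adjoint (Rop (ebasis i)).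

Definition Top : V -> V := fun x => \sum_(i < d) Lsum i (Rsum i x).

Lemma hdot_ebasis i j : hdot (ebasis i) (ebasis j) = (i == j)%:R.
Proof.
rewrite /hdot (bigD1 i) //= big1 => [|k /negPf ki].
  by rewrite !mxE !eqxx mul1r addr0 rmorph_nat.
by rewrite !mxE ki andbF mul0r.
Qed.

Lemma tensor0 : tensor [::] = vacuum.
Proof.
by apply/funext => -[|i w] //; rewrite /tensor /vacuum /= big_nil.
Qed.

Lemma Lop_tensor v vs : Lop v (tensor vs) = tensor (v :: vs).
Proof.
apply/funext => -[|i w]; rewrite /tensor /= ?eqSS //.
by case: eqP => _; rewrite ?mulr0 // big_cons.
Qed.

Lemma Rop_tensor v vs : Rop v (tensor vs) = tensor (rcons vs v).
Proof.
apply/funext => -[|i w]; rewrite /tensor size_rcons //= size_belast eqSS.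
case: eqP => [sz|_]; last by rewrite mul0r.
by rewrite -/(zip _ (i :: w)) lastI zip_rcons ?size_belast // big_rcons.
Qed.

Lemma level_inner_tensor n (v w : 'I_n -> 'rV[C]_d) :
  level_inner n (tensor (codom v)) (tensor (codom w)) =
  \sum_(u : 'S_n) q%:C ^+ inversions u * \prod_(i < n) hdot (v i) (w (u i)).
Proof.
have tE (f : 'I_n -> 'rV[C]_d) (s : n.-tuple 'I_d) :
    tensor (codom f) s = \prod_(i < n) f i 0 (tnth s i).
  rewrite /tensor size_codom card_ord size_tuple eqxx -{1}(map_tnth_enum s).
  by rewrite /codom /image_mem zip_map big_map big_enum.
rewrite /level_inner.
transitivity (\sum_(u : 'S_n) q%:C ^+ inversions u *
  \sum_(s : n.-tuple 'I_d) \sum_(t : n.-tuple 'I_d)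
    tensor (codom v) s * (tensor (codom w) t)^* *
    \prod_(i < n) hdot (ebasis (tnth s i)) (ebasis (tnth t (u i)))).
  rewrite [LHS](eq_bigr (fun s : n.-tuple 'I_d => \sum_(u : 'S_n)
      \sum_(t : n.-tuple 'I_d) q%:C ^+ inversions u *
        (tensor (codom v) s * (tensor (codom w) t)^* *
         \prod_(i < n) hdot (ebasis (tnth s i)) (ebasis (tnth t (u i)))))).
    by rewrite exchange_big; apply: eq_bigr => u _; rewrite mulr_sumr;
      apply: eq_bigr => s _; rewrite mulr_sumr.
  move=> s _; rewrite exchange_big; apply: eq_bigr => t _ /=.
  by rewrite mulr_sumr; apply: eq_bigr => u _; rewrite mulrCA.
apply: eq_bigr => u _; congr (_ * _).
pose toT (f : {ffun 'I_n -> 'I_d}) := [tuple f i | i < n].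
have toTK f i : tnth (toT f) i = f i by rewrite tnth_mktuple.
rewrite (reindex toT); last first.
  exists (fun s => [ffun i => tnth s i]) => [f|s] _.
    by apply/ffunP => i; rewrite ffunE toTK.
  by apply: eq_from_tnth => i; rewrite toTK ffunE.
rewrite [RHS]bigA_distr_bigA; apply: eq_bigr => f _.
move: (toT f) (toTK f) => s sE /=.
have [t0 t0E] : exists t : n.-tuple 'I_d, forall i, tnth t i = f ((u^-1)%g i).
  by exists [tuple f ((u^-1)%g i) | i < n] => i; rewrite tnth_mktuple.
rewrite (bigD1 t0) //= [X in _ + X]big1 ?addr0 => [|t tt0].
  rewrite [X in _ * X = _]big1 ?mulr1 => [|i _]; last first.
    by rewrite hdot_ebasis sE t0E permK eqxx.
  rewrite !tE rmorph_prod /= [X in _ * X](reindex_inj (@perm_inj _ u)) /=.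
  rewrite -big_split /=; apply: eq_bigr => i _.
  by rewrite sE t0E permK.
have [i ti] : exists i, tnth t i != tnth t0 i.
  apply/existsP; rewrite -negb_forall; apply: contra tt0 => /forallP tt0.
  by apply/eqP/eq_from_tnth => i; apply/eqP.
rewrite (bigD1 ((u^-1)%g i)) //= permKV hdot_ebasis sE.
by move: ti; rewrite t0E eq_sym => /negPf ->; rewrite mul0r mulr0.
Qed.

End QFock.

Arguments Top {R} d q x _ : rename.

Definition compactly_supported (R : realType)
    (nu : probability (measurableTypeR R) R) : Prop :=
  exists2 K : set R, compact K & nu (~` K) = 0%E.

(* Compactly supported measures are determined by their moments, so at most one
   [nu] satisfies this. *)
Definition is_distribution (R : realType) (d : nat)
    (phi : (qvec R d -> qvec R d) -> R[i]) (A : qvec R d -> qvec R d)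
    (nu : probability (measurableTypeR R) R) : Prop :=
  compactly_supported nu /\
  forall n : nat, (0 < n)%N ->
    (\int[nu]_x (x ^+ n))%:C = phi (fun x => iter n A x).

(* Main.v *)
(** The kernel [q^inv(s^-1 t)] on permutations is [q] to the size of the symmetric
    difference of the inversion sets of [s] and [t], hence a restriction of a tensor
    power of the positive definite matrix [[1, q], [q, 1]]; so the q-inner product is
    positive definite.  The adjoint of [L_i] is the q-annihilation operator [l_i],
    and [l_i L_j = delta_ij + q L_j l_i] gives boundedness by induction on the level.

    The operators [X_i = L_i + L_i^*] and [Y_j = R_j + R_j^*] commute and agree on
    the vacuum, so [T] is selfadjoint, and moving every [Y] to the right turns
    [T^n] on the vacuum into the sum over [i] of
    [X_i1 ... X_in X_in ... X_i1] on the vacuum.  By the q-Wick formula the moment is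
    the sum over pair partitions [pi] of [q^cr(pi)] times the number of colourings
    of [1, ..., 2n] by [1, ..., d] that are constant on the blocks of [pi] and of the
    rainbow, which is [d^|pi v rho|].

    To get the measure, quadratures matching the first [N] moments are produced by
    the finite-dimensional spectral theorem.  Their quantile functions are monotone,
    so their Riemann sums are close to their integrals uniformly in [N]; hence a
    pointwise limit along an ultrafilter is a quantile function of the distribution
    sought. *)
From HB Require Import structures.
Require Import Defs.
From mathcomp Require Import all_boot all_order all_algebra.
From mathcomp Require Import complex.
From mathcomp Require Import all_classical all_reals all_analysis.
From mathcomp Require Import all_fingroup measurable_realfun.
From mathcomp Require Import ring lra zify.

Set Implicit Arguments.
Unset Strict Implicit.
Unset Printing Implicit Defensive.

Import Order.TTheory GRing.Theory Num.Theory.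
Import numFieldNormedType.Exports.
Local Open Scope classical_set_scope.
Local Open Scope ring_scope.

(** The adjoint in the statement is a choice, pinned down only on square-summable families. The
    algebra is therefore done with the explicit operators [annl], [annr], [Xop] and [Yop] on
    arbitrary coordinate families, where identities hold pointwise, and is transferred by uniqueness
    of adjoints.

    The scalar q-Wick formula does not feed its own induction: peeling off the first field operator
    leaves a vector, not a number. All coordinates of that vector are described at once, by
    involutions whose fixed points are the letters still present.

    The measure is built from the moments [m] alone. Since [T] is bounded and selfadjoint, M<x,x> +
    <Tx,x> and M<x,x> - <Tx,x> are nonnegative for some M. For x in the span of the iterates of [T]
    on the vacuum these are the Hankel forms with entries M m_(i+j) + m_(i+j+1) and M m_(i+j) -
    m_(i+j+1), and together they confine the nodes of every quadrature to [-M, M]. This one bound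
    gives both the compact support and a Riemann sum error of order 1/k with a constant independent
    of N. A Riemann sum involves finitely many values of a quantile function, so the estimate
    survives pointwise limits. *)

Local Notation "x %:C" := (real_complex _ x) : ring_scope.

(** * Positive definiteness of the inversion kernel *)

Section Walsh.
Variables (C : numClosedFieldType) (I T : finType) (D : T -> I -> bool).
Variable q : C.
Hypothesis hq : -1 < q < 1.

(** The matrix [[1, q], [q, 1]] is (1 + q)/2 times the square of (1, 1) plus (1 - q)/2 times the
    square of (1, -1). Expanding its tensor power gives the characters [chi E] of the cube with the
    coefficients [weight E]. *)
Let chi (E : {set I}) (s : T) : C := \prod_p (if p \in E then (-1) ^+ D s p else 1).
Let weight (E : {set I}) : C :=
  \prod_p (if p \in E then (1 - q) / 2 else (1 + q) / 2).

Let hamming_walsh (s t : T) :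
  q ^+ (\sum_p (D s p != D t p)) = \sum_(E : {set I}) weight E * (chi E s * chi E t).
Proof.
rewrite -prodrXr.
transitivity (\prod_p ((1 - q) / 2 * ((-1) ^+ D s p * (-1) ^+ D t p) + (1 + q) / 2)).
  apply: eq_bigr => p _; have two0 : (2 : C) != 0 by rewrite pnatr_eq0.
  by case: (D s p); case: (D t p); rewrite /= ?expr0 ?expr1; field.
rewrite bigA_distr; apply: eq_bigr => E _.
rewrite -!big_split /=; apply: eq_bigr => p _.
by case: ifP => _; rewrite ?mulr1.
Qed.

Let weight_gt0 E : 0 < weight E.
Proof.
case/andP: hq => q1 q2; apply: prodr_gt0 => p _.
by case: ifP => _; rewrite divr_gt0 ?ltr0n // ?subr_gt0 // -ltrBlDl sub0r.
Qed.

Let chi_conj E s : (chi E s)^* = chi E s.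
Proof.
rewrite /chi rmorph_prod; apply: eq_bigr => p _; case: ifP => _; last by rewrite rmorph1.
by rewrite rmorphXn rmorphN rmorph1.
Qed.

Definition hamming_form (c : T -> C) : C :=
  \sum_s \sum_t q ^+ (\sum_p (D s p != D t p)) * (c s * (c t)^*).

Let hamming_formE c : hamming_form c =
  \sum_(E : {set I}) weight E * ((\sum_s chi E s * c s) * (\sum_s chi E s * c s)^*).
Proof.
rewrite /hamming_form.
under eq_bigr => s _ do (under eq_bigr => t _ do rewrite hamming_walsh mulr_suml).
under eq_bigr => s _ do rewrite exchange_big.
rewrite exchange_big; apply: eq_bigr => E _.
rewrite rmorph_sum mulr_suml mulr_sumr; apply: eq_bigr => s _.
rewrite !mulr_sumr; apply: eq_bigr => t _.
rewrite rmorphM /= chi_conj; ring.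
Qed.

Lemma hamming_form_ge0 c : 0 <= hamming_form c.
Proof.
rewrite hamming_formE; apply: sumr_ge0 => E _.
by apply: mulr_ge0; [exact/ltW/weight_gt0 | exact: mul_conjC_ge0].
Qed.

(* If the form vanishes then so do all Walsh coefficients of [c], and summing them
   recovers the value at the point with all coordinates [false]. *)
Lemma hamming_form_eq0 c s0 : (forall s, (forall p, D s p = false) <-> s = s0) ->
  hamming_form c = 0 -> c s0 = 0.
Proof.
move=> s0P /eqP; rewrite hamming_formE psumr_eq0; last first.
  move=> E _; by apply: mulr_ge0; [exact/ltW/weight_gt0 | exact: mul_conjC_ge0].
move=> /allP/= h.
have {h} h E : \sum_s chi E s * c s = 0.
  have /h : E \in index_enum {set I} by rewrite mem_index_enum.
  by rewrite mulf_eq0 gt_eqF ?weight_gt0 //= mul_conjC_eq0 => /eqP.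
have : \sum_(E : {set I}) \sum_s chi E s * c s = 0 by rewrite big1.
rewrite exchange_big /=.
under eq_bigr => s _ do rewrite -mulr_suml.
have chiS s : \sum_(E : {set I}) chi E s = \prod_p ((-1) ^+ D s p + 1).
  by rewrite bigA_distr.
rewrite (bigD1 s0) //= [X in _ + X]big1 ?addr0; last first.
  move=> s ss0; rewrite chiS.
  have [p Dp] : exists p, D s p.
    apply/existsP; apply: contraNT ss0; rewrite negb_exists => /forallP h'.
    by apply/eqP/s0P => p; apply/negbTE/h'.
  by rewrite (bigD1 p) //= Dp expr1 addNr mul0r mul0r.
move/eqP; rewrite mulf_eq0 => /orP[|/eqP //]; rewrite chiS prodf_seq_eq0 => /hasP[p _].
by have /s0P/(_ p) -> := erefl s0; rewrite expr0 /= -[1 + 1]/(2%:R) pnatr_eq0.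
Qed.

End Walsh.

(** * Inversion sets of permutations *)

Section Inversions.

Lemma inversionsE n (u : 'S_n) :
  inversions u = (\sum_(p : 'I_n * 'I_n) ((p.1 < p.2) && (u p.2 < u p.1)))%N.
Proof.
rewrite /inversions -sum1_card big_mkcond /=; apply: eq_bigr => p _.
by rewrite inE; case: (_ && _).
Qed.

Definition inverted n (s : 'S_n) (p : 'I_n * 'I_n) : bool :=
  (p.1 < p.2)%N && (s p.2 < s p.1)%N.

(** A pair i, j contributes to the left side exactly when s and t order its images differently.
    After reindexing by s, pairs of both orientations occur, and the swap of coordinates folds them
    onto i < j. *)
Lemma inversions_mulV n (s t : 'S_n) :
  inversions (s^-1 * t)%g = (\sum_p (inverted s p != inverted t p))%N.
Proof.
rewrite inversionsE (reindex (fun p : 'I_n * 'I_n => (s p.1, s p.2))) /=; last first.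
  exists (fun p => ((s^-1)%g p.1, (s^-1)%g p.2)) => -[i j] _ /=; first by rewrite !permK.
  by rewrite !permKV.
under eq_bigr => p _ do rewrite !permM !permK.
rewrite (bigID (fun p : 'I_n * 'I_n => (p.1 < p.2)%N)) /=.
rewrite [X in (_ + X)%N](reindex_inj (h := fun p : 'I_n * 'I_n => (p.2, p.1))) /=; last first.
  by move=> [i j] [i' j'] [-> ->].
rewrite ![X in (X + _)%N]big_mkcond [X in (_ + X)%N]big_mkcond -big_split /=.
apply: eq_bigr => -[i j] _; rewrite /inverted /=.
have nts (v : 'S_n) : (i < j)%N -> (v i < v j)%N = ~~ (v j < v i)%N.
  move=> ij; rewrite -leqNgt ltn_neqAle; case: eqP => //= /val_inj/perm_inj E.
  by rewrite E ltnn in ij.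
case: (ltngtP i j) => [ij|ij|/val_inj ->] /=.
- by rewrite !nts //; case: (_ < _)%N; case: (_ < _)%N.
- by [].
- by rewrite !ltnn.
Qed.

Lemma inversionsV n (s : 'S_n) : inversions s^-1 = inversions s.
Proof.
have := inversions_mulV s 1; rewrite mulg1 => ->.
have := inversions_mulV 1 s; rewrite invg1 mul1g => ->.
by apply: eq_bigr => p _; rewrite eq_sym.
Qed.

Lemma inversions_rev n (s : 'S_n) (r : 'S_n) : (forall i, r i = rev_ord i) ->
  inversions (r * s * r)%g = inversions s.
Proof.
move=> rE; rewrite !inversionsE (reindex_inj (h := fun p : 'I_n * 'I_n => (r p.2, r p.1))); last first.
  by move=> [i j] [i' j'] [/perm_inj -> /perm_inj ->].
apply: eq_bigr => -[i j] _; rewrite /= !permM !rE !rev_ordK /=.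
congr nat_of_bool; move: (ltn_ord i) (ltn_ord j) (ltn_ord (s i)) (ltn_ord (s j)) => *.
by congr (_ && _); lia.
Qed.

(** Without inversions the values of s are listed in increasing order, and a list has only one
    sorted rearrangement. *)
Lemma inverted_eq1 n (s : 'S_n) : (forall p, inverted s p = false) <-> s = 1%g.
Proof.
split=> [h|-> [i j]]; last by rewrite /inverted !perm1 /=; lia.
have mono (i j : 'I_n) : (i <= j)%N -> (s i <= s j)%N.
  rewrite leq_eqVlt => /orP[/eqP/val_inj -> //|ij].
  by rewrite leqNgt; have := h (i, j); rewrite /inverted ij /= => ->.
have sorts : sorted leq [seq val (s i) | i <- enum 'I_n].
  rewrite sorted_map; apply: (sub_sorted (e := fun i j : 'I_n => (i <= j)%N)); first exact: mono.
  have := iota_sorted 0 n; rewrite -val_enum_ord sorted_map; exact: sub_sorted.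
have E : [seq val (s i) | i <- enum 'I_n] = [seq val i | i <- enum 'I_n].
  apply: (sorted_eq leq_trans anti_leq) => //.
    by rewrite val_enum_ord iota_sorted.
  rewrite (map_comp val s); apply: perm_map.
  apply: uniq_perm; rewrite ?(map_inj_uniq (@perm_inj _ s)) ?enum_uniq //.
  move=> i; rewrite mem_enum; apply/mapP; exists ((s^-1)%g i); rewrite ?mem_enum ?permKV //.
apply/permP => i; rewrite perm1; apply: val_inj.
by move/eq_in_map: E => /(_ i) -> //; rewrite mem_enum.
Qed.

(** The value k at position 0 is inverted with exactly the k smaller values, and [bump k] keeps the
    relative order of all the others. *)
Lemma inversions_lift n (k : 'I_n.+1) (s : 'S_n) :
  inversions (lift_perm ord0 k s) = (k + inversions s)%N.
Proof.
rewrite !inversionsE -(pair_bigA _ (fun i j : 'I_n.+1 =>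
  (((i < j) && (lift_perm ord0 k s j < lift_perm ord0 k s i))%N : nat))) /=.
rewrite -(pair_bigA _ (fun i j : 'I_n => (((i < j) && (s j < s i))%N : nat))) /=.
have bumpS (i j : nat) : (bump k i < bump k j)%N = (i < j)%N.
  by rewrite /bump; case: (leqP k i); case: (leqP k j); lia.
rewrite big_ord_recl; congr (_ + _)%N; last first.
  apply: eq_bigr => i _; rewrite big_ord_recl /= add0n.
  by apply: eq_bigr => j _; rewrite !lift_perm_lift /= bumpS.
rewrite big_ord_recl /= add0n.
transitivity (\sum_(j < n) (j < k))%N; last first.
  rewrite -(big_mkord xpredT (fun j => ((j < k)%N : nat))) (big_cat_nat (n := k)) //=; last first.
    by rewrite -ltnS ltn_ord.
  rewrite (eq_big_nat _ _ (F2 := fun=> 1%N)) => [|i /andP[_ ->] //].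
  rewrite sum_nat_const_nat subn0 muln1 big_nat_cond big1 ?addn0 // => i.
  by rewrite andbT => /andP[+ _]; rewrite leqNgt => /negbTE ->.
rewrite [RHS](reindex_inj (@perm_inj _ s)); apply: eq_bigr => j _.
rewrite lift_perm_id lift_perm_lift /= /bump.
by congr (_ : nat); case: (leqP k (s j)); lia.
Qed.

End Inversions.

(** * The inner product on a level *)

Lemma conjCR (R : rcfType) (x : R) : (x%:C : R[i])^* = x%:C.
Proof. exact: conjc_real. Qed.

Section Conjugation.
Variable C : numClosedFieldType.
Implicit Types x y : C.

Lemma conjCD x y : (x + y)^* = x^* + y^*. Proof. exact: rmorphD. Qed.
Lemma conjCM x y : (x * y)^* = x^* * y^*. Proof. exact: rmorphM. Qed.
Lemma conjCX x n : (x ^+ n)^* = x^* ^+ n. Proof. exact: rmorphXn. Qed.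
Lemma conjC_sum (I : Type) (r : seq I) (P : pred I) (F : I -> C) :
  (\sum_(i <- r | P i) F i)^* = \sum_(i <- r | P i) (F i)^*.
Proof. exact: rmorph_sum. Qed.

End Conjugation.

HB.lock
Definition permt (T : Type) n (u : 'S_n) (t : n.-tuple T) : n.-tuple T :=
  [tuple tnth t (u i) | i < n].

Lemma tnth_permt (T : Type) n (u : 'S_n) (t : n.-tuple T) i :
  tnth (permt u t) i = tnth t (u i).
Proof. by rewrite permt.unlock tnth_mktuple. Qed.

Section LevelForm.
Variables (R : realType) (d : nat) (q : R).
Local Notation C := R[i].
Local Notation V := (qvec R d).
Local Notation H := (level_inner q).

Lemma permtM (T : Type) n (u v : 'S_n) (t : n.-tuple T) :
  permt (u * v)%g t = permt u (permt v t).
Proof. by apply: eq_from_tnth => i; rewrite !tnth_permt permM. Qed.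

Lemma permt1 (T : Type) n (t : n.-tuple T) : permt 1 t = t.
Proof. by apply: eq_from_tnth => i; rewrite !tnth_permt perm1. Qed.

Lemma permt_bij (T : Type) n (u : 'S_n) : bijective (@permt T n u).
Proof.
by exists (@permt T n u^-1%g) => t; rewrite -permtM ?mulVg ?mulgV permt1.
Qed.

(** Orthonormality of the basis kills every word s other than [permt u t]. *)
Lemma level_innerE n (x y : V) : H n x y = \sum_(u : 'S_n) q%:C ^+ inversions u *
  \sum_(t : n.-tuple 'I_d) x (permt u t) * (y t)^*.
Proof.
rewrite /level_inner exchange_big /=.
under eq_bigr => t _ do (under eq_bigr => s _ do rewrite mulr_sumr).
under eq_bigr => t _ do rewrite exchange_big /=.
rewrite exchange_big /=; apply: eq_bigr => u _; rewrite mulr_sumr.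
apply: eq_bigr => t _; rewrite (bigD1 (permt u t)) //= [X in _ + X]big1 ?addr0.
  rewrite big1 ?mulr1 1?mulrC // => i _.
  by rewrite tnth_permt hdot_ebasis eqxx.
move=> s st; have [i si] : exists i, tnth s i != tnth t (u i).
  apply/existsP; rewrite -negb_forall; apply: contra st => /forallP h.
  by apply/eqP/eq_from_tnth => i; rewrite tnth_permt; exact/eqP.
by rewrite (bigD1 i) //= hdot_ebasis (negbTE si) mul0r !mulr0.
Qed.

Lemma level_inner_sym n (x y : V) : (H n x y)^* = H n y x.
Proof.
rewrite !level_innerE conjC_sum [RHS](reindex_inj (@invg_inj _)).
apply: eq_bigr => u _; rewrite inversionsV conjCM conjCX conjCR.
congr (_ * _); rewrite conjC_sum [RHS](reindex (permt u)); last exact/onW_bij/permt_bij.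
apply: eq_bigr => t _; rewrite -permtM mulVg permt1 conjCM conjCK; exact: mulrC.
Qed.

(** Averaging over the action of the symmetric group on positions turns the kernel into a function
    of two permutations. For y = x the inner double sum is then, for each word t, a [hamming_form]
    in the function sending s to [x (permt s t)]. *)
Lemma level_inner_factE n (x y : V) : n`!%:R * H n x y =
  \sum_(t : n.-tuple 'I_d) \sum_(s : 'S_n) \sum_(s' : 'S_n)
    q%:C ^+ (\sum_p (inverted s^-1%g p != inverted s'^-1%g p)) *
    (x (permt s t) * (y (permt s' t))^*).
Proof.
rewrite -{1}(card_Sn n) -sum1_card natr_sum mulr_suml.
transitivity (\sum_(s' : 'S_n) \sum_(s : 'S_n) \sum_(t : n.-tuple 'I_d)
    q%:C ^+ (\sum_p (inverted s^-1%g p != inverted s'^-1%g p)) *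
    (x (permt s t) * (y (permt s' t))^*)).
  apply: eq_bigr => s' _; rewrite mul1r level_innerE (reindex_inj (mulIg (s'^-1)%g)).
  apply: eq_bigr => s _; rewrite (reindex (permt s')); last exact/onW_bij/permt_bij.
  rewrite mulr_sumr; apply: eq_bigr => t _.
  by rewrite -permtM mulgKV -inversions_mulV invgK.
rewrite [RHS]exchange_big [LHS]exchange_big; apply: eq_bigr => s _ /=.
by rewrite [RHS]exchange_big.
Qed.

Lemma level_innerDZ n a (x y z : V) : H n (a *: x + y) z = a * H n x z + H n y z.
Proof.
rewrite !level_innerE mulr_sumr -big_split; apply: eq_bigr => u _ /=.
rewrite mulrCA -mulrDr; congr (_ * _).
by rewrite mulr_sumr -big_split; apply: eq_bigr => t _ /=; rewrite mulrA -mulrDl.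
Qed.

Lemma eq_level_inner n (x x' y y' : V) :
  (forall w, size w = n -> x w = x' w) -> (forall w, size w = n -> y w = y' w) ->
  H n x y = H n x' y'.
Proof.
move=> ex ey; rewrite !level_innerE; apply: eq_bigr => u _; congr (_ * _).
by apply: eq_bigr => t _; rewrite ex ?ey ?size_tuple.
Qed.

Lemma level_inner0 (x y : V) : H 0 x y = x [::] * (y [::])^*.
Proof.
have pE (u : 'S_0) : u = 1%g by apply/permP => -[].
rewrite level_innerE (bigD1 1%g) //= [X in _ + X]big1 ?addr0 => [|u]; last by rewrite (pE u) eqxx.
have -> : inversions (1 : 'S_0) = 0%N.
  by rewrite inversionsE big1 // => -[[]].
rewrite expr0 mul1r (bigD1 [tuple]) //= big1 ?addr0 => [|t]; last by rewrite [t]tuple0 => /eqP.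
by rewrite permt1.
Qed.

Hypothesis hq : -1 < q < 1.

Let hqC : -1 < q%:C < 1.
Proof. by have := hq; rewrite -!ltcR /= rmorphN rmorph1. Qed.

Let factC_gt0 n : (0 : C) < n`!%:R.
Proof. by rewrite ltr0n fact_gt0. Qed.

Lemma level_inner_ge0 n (x : V) : 0 <= H n x x.
Proof.
rewrite -(pmulr_rge0 _ (factC_gt0 n)) level_inner_factE; apply: sumr_ge0 => t _.
exact: (hamming_form_ge0 (fun s : 'S_n => inverted s^-1%g) hqC (fun s => x (permt s t))).
Qed.

(** The nonnegative Hamming forms must vanish one by one. The identity is the only permutation with
    empty inversion set, so the form attached to w itself determines [x w]. *)
Lemma level_inner_eq0 n (x : V) w : H n x x = 0 -> size w = n -> x w = 0.
Proof.
move=> Hx sw; have /esym/eqP := level_inner_factE n x x.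
rewrite Hx mulr0 psumr_eq0 => [/allP h|t _]; last first.
  exact: (hamming_form_ge0 (fun s : 'S_n => inverted s^-1%g) hqC (fun s => x (permt s t))).
have swb : size w == n by apply/eqP.
have /h/= : Tuple swb \in index_enum (n.-tuple 'I_d : finType) by rewrite mem_index_enum.
move=> /eqP/(hamming_form_eq0 hqC (c := fun s => x (permt s (Tuple swb))) (s0 := 1%g)).
rewrite permt1; apply => s; rewrite inverted_eq1.
by split=> [/(congr1 invg)|->]; rewrite ?invgK invg1.
Qed.

End LevelForm.

(** * Annihilation operators *)

Lemma ReD (R : rcfType) (x y : R[i]) : complex.Re (x + y) = complex.Re x + complex.Re y.
Proof. by case: x y => [a b] [c e]. Qed.

Lemma ImD (R : rcfType) (x y : R[i]) : complex.Im (x + y) = complex.Im x + complex.Im y.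
Proof. by case: x y => [a b] [c e]. Qed.

Lemma ReZ (R : rcfType) (t : R) (z : R[i]) : complex.Re (t%:C * z) = t * complex.Re z.
Proof. by case: z => [a b] /=; rewrite mul0r subr0. Qed.

Lemma Re_conjC (R : rcfType) (z : R[i]) : complex.Re z^* = complex.Re z.
Proof. by case: z. Qed.

Lemma Im_conjC (R : rcfType) (z : R[i]) : complex.Im z^* = - complex.Im z.
Proof. by case: z. Qed.

Lemma big_perm_lift (R : nmodType) n (F : 'S_n.+1 -> R) :
  \sum_u F u = \sum_k \sum_s F (lift_perm ord0 k s).
Proof.
rewrite pair_big /= (reindex (fun p : 'I_n.+1 * 'S_n => lift_perm ord0 p.1 p.2)) //=.
apply: onW_bij; apply: inj_card_bij => [[k s] [k' s'] /= e|]; last first.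
  by rewrite card_prod !card_Sn card_ord factS.
have ek : k = k' by rewrite -(lift_perm_id ord0 k s) e lift_perm_id.
rewrite -ek in e *; congr (_, _); apply/permP => i.
by apply: (@lift_inj _ k); rewrite -!(lift_perm_lift ord0) e.
Qed.

HB.lock
Definition insert_tuple (T : Type) n (k : 'I_n.+1) (a : T) (t : n.-tuple T) :=
  [tuple if unlift k j is Some j' then tnth t j' else a | j < n.+1].

Lemma tnth_insert_tuple_id (T : Type) n k (a : T) (t : n.-tuple T) :
  tnth (insert_tuple k a t) k = a.
Proof. by rewrite insert_tuple.unlock tnth_mktuple unlift_none. Qed.

Lemma tnth_insert_tuple_lift (T : Type) n k (a : T) (t : n.-tuple T) j :
  tnth (insert_tuple k a t) (lift k j) = tnth t j.
Proof. by rewrite insert_tuple.unlock tnth_mktuple liftK. Qed.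

Lemma val_insert_tuple (T : Type) n (k : 'I_n.+1) (a : T) (t : n.-tuple T) :
  insert_tuple k a t = take k t ++ a :: drop k t :> seq T.
Proof.
have kn : (k <= n)%N by rewrite -ltnS.
have szk : size (take k t) = k by rewrite size_take size_tuple; case: ltngtP kn => // ->.
apply: (@eq_from_nth _ a) => [|j].
  by rewrite size_tuple size_cat /= size_drop szk size_tuple; lia.
rewrite size_tuple => jn; rewrite -[j]/(val (Ordinal jn)) -tnth_nth.
case: (unliftP k (Ordinal jn)) => [j'|] ->.
  rewrite tnth_insert_tuple_lift nth_cat szk /= /bump.
  case: (leqP k j') => kj /=.
    rewrite add1n ltnNge ltnW //= subSn //= nth_drop addnC subnK // (tnth_nth a) //.
  by rewrite add0n kj nth_take // (tnth_nth a).
by rewrite tnth_insert_tuple_id nth_cat szk ltnn subnn.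
Qed.

Lemma big_insert_tuple (R : nmodType) (T : finType) n (k : 'I_n.+1) (F : n.+1.-tuple T -> R) :
  \sum_t F t = \sum_a \sum_t F (insert_tuple k a t).
Proof.
rewrite pair_big /= (reindex (fun p : T * n.-tuple T => insert_tuple k p.1 p.2)) //=.
apply: onW_bij; apply: inj_card_bij => [[a t] [a' t'] /= e|]; last first.
  by rewrite card_prod !card_tuple expnS.
congr (_, _); first by rewrite -(tnth_insert_tuple_id k a t) e tnth_insert_tuple_id.
by apply: eq_from_tnth => j; rewrite -(tnth_insert_tuple_lift k a t) e tnth_insert_tuple_lift.
Qed.

Section Annihilation.
Variables (R : realType) (d : nat) (q : R).
Local Notation C := R[i].
Local Notation V := (qvec R d).
Local Notation H := (level_inner q).
Implicit Types (i j : 'I_d) (x y : V) (w : seq 'I_d).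

(** The q-annihilation operator of e_i deletes a letter i at position k of a basis word, with weight
    q^k. In coordinates deletion becomes insertion: the value at w collects the words obtained by
    inserting i into w. *)
Definition annl i y : V := fun w =>
  \sum_(k < (size w).+1) q%:C ^+ k * y (take k w ++ i :: drop k w).

Definition reversal x : V := fun w => x (rev w).

Definition annr i y : V := reversal (annl i (reversal y)).

(** This is q^N for the number operator N. It arises when a letter is annihilated from the opposite
    end of a word, past all the other letters. *)
Definition number_pow x : V := fun w => q%:C ^+ size w * x w.

Lemma reversalK : involutive reversal.
Proof. by move=> x; apply/funext => w; rewrite /reversal revK. Qed.

(** Conjugation by the order-reversing permutation preserves the number of inversions. This reduces
    every statement on right operators to one on left operators. *)
Lemma level_inner_reversal n x y : H n (reversal x) (reversal y) = H n x y.
Proof.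
pose r : 'S_n := perm (@rev_ord_inj n).
have rE (k : 'I_n) : r k = rev_ord k by rewrite permE.
have rr : (r * r)%g = 1%g by apply/permP => k; rewrite permM !rE rev_ordK perm1.
have permr (t : n.-tuple 'I_d) : permt r t = rev t :> seq 'I_d.
  (* Degree 0 is separated because [nth] needs a letter as default value. *)
  clear x y; clearbody r; case: n r rE rr t => [r _ _ t|n r rE _ t].
    by rewrite [t]tuple0 [RHS]/=; apply/nilP; rewrite /nilp size_tuple.
  have i0 := tnth t ord0.
  apply: (@eq_from_nth _ i0) => [|j]; first by rewrite size_rev !size_tuple.
  rewrite size_tuple => jn; rewrite nth_rev ?size_tuple //.
  rewrite -[j]/(val (Ordinal jn)) -tnth_nth tnth_permt rE (tnth_nth i0) /=.
  by rewrite subSS.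
have rV : (r^-1 = r)%g by apply/eqP; rewrite eq_invg_mul rr.
rewrite !level_innerE [RHS](reindex_inj (mulgI r)) [RHS](reindex_inj (mulIg r)).
apply: eq_bigr => u _; rewrite mulgA inversions_rev //; congr (_ * _).
rewrite [RHS](reindex (permt r)); last exact/onW_bij/permt_bij.
apply: eq_bigr => t _; rewrite /reversal -!permr -!permtM.
by rewrite -!mulgA rr mulg1.
Qed.

Lemma Rop_reversal v x : Rop v x = reversal (Lop v (reversal x)).
Proof.
apply/funext => -[|a w] //; rewrite -[LHS]/(x (belast a w) * v 0 (last a w)).
by rewrite /reversal lastI rev_rcons /= revK mulrC.
Qed.

Lemma Rop_rcons v x w b : Rop v x (rcons w b) = x w * v 0 b.
Proof. by rewrite Rop_reversal /reversal rev_rcons /= revK mulrC. Qed.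

Lemma ebasisE i (a : 'I_d) : (@ebasis R d i) 0 a = (i == a)%:R.
Proof. by rewrite mxE eqxx eq_sym. Qed.

(** Insertion at position 0 meets the new letter j itself; any later insertion happens behind it and
    costs one more factor q. *)
Lemma annl_Lop i j x :
  annl i (Lop (ebasis R j) x) = (i == j)%:R *: x + q%:C *: Lop (ebasis R j) (annl i x).
Proof.
apply/funext => w; rewrite /annl big_ord_recl take0 drop0 /= ebasisE expr0 mul1r eq_sym.
congr (_ * _ + _); case: w => [|a w] /=; first by rewrite big_ord0 [RHS]mulr0.
rewrite -[RHS]/(q%:C * (ebasis R j 0 a * annl i x w)) /annl mulrCA !mulr_sumr.
apply: eq_bigr => k _; rewrite /bump /= add1n exprS; ring.
Qed.

Lemma annl_Rop i j x :
  annl i (Rop (ebasis R j) x) = (i == j)%:R *: number_pow x + Rop (ebasis R j) (annl i x).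
Proof.
apply/funext => w; rewrite /annl big_ord_recr /= take_size drop_size cats1 Rop_rcons.
rewrite ebasisE addrC; congr (_ + _).
  by rewrite -[RHS]/(_ * (_ * x w)) eq_sym; ring.
elim/last_ind: w => [|w b _]; first by rewrite big_ord0.
rewrite Rop_rcons mulr_suml size_rcons; apply: eq_bigr => k _.
have kw : (k <= size w)%N by rewrite -ltnS.
rewrite -cats1 takel_cat // drop_cat; case: ltngtP kw => // [_|->] _.
  by rewrite -cat_cons catA cats1 Rop_rcons mulrA.
by rewrite take_size subnn /= drop_size -[[:: i; b]]/([:: i] ++ [:: b]) catA cats1 Rop_rcons mulrA.
Qed.

Lemma Lop_Rop v v' x : Lop v (Rop v' x) = Rop v' (Lop v x).
Proof.
apply/funext; case=> [|a w] //; elim/last_ind: w => [|w b _].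
  by rewrite /= mulr0 mul0r.
by rewrite [LHS]/= -rcons_cons !Rop_rcons /= mulrA.
Qed.

Lemma annr_Lop i j x :
  annr i (Lop (ebasis R j) x) = (i == j)%:R *: number_pow x + Lop (ebasis R j) (annr i x).
Proof.
have -> : Lop (ebasis R j) x = reversal (Rop (ebasis R j) (reversal x)).
  by rewrite Rop_reversal !reversalK.
rewrite /annr reversalK annl_Rop Rop_reversal; apply/funext => w.
by rewrite -[in LHS]/(_ * _ + _) [LHS]/reversal /= -[LHS]/(_ * _ + _) /number_pow /reversal size_rev !revK.
Qed.

(** Permutations are sorted by the position k that they match with the first letter. It accounts for
    k inversions, hence for q^k, and forces the k-th letter in the coordinates of y to be i. *)
Lemma level_inner_Lop n i x y : H n.+1 (Lop (ebasis R i) x) y = H n x (annl i y).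
Proof.
rewrite !level_innerE big_perm_lift exchange_big; apply: eq_bigr => s _ /=.
under eq_bigr => k _ do rewrite inversions_lift exprD -mulrA mulrCA.
rewrite -mulr_sumr; congr (_ * _).
have beheadE k (t : n.-tuple 'I_d) :
    behead (permt (lift_perm ord0 k s) (insert_tuple k i t)) = permt s t :> seq _.
  apply: (congr1 val (x := [tuple of behead _])); apply: eq_from_tnth => j.
  rewrite tnth_behead !tnth_permt.
  have -> : inord j.+1 = lift ord0 j by apply: val_inj; rewrite /= inordK ?ltnS.
  by rewrite lift_perm_lift tnth_insert_tuple_lift.
transitivity (\sum_(k < n.+1) \sum_(t : n.-tuple 'I_d)
    q%:C ^+ k * (x (permt s t) * (y (insert_tuple k i t))^*)).
  apply: eq_bigr => k _; rewrite (big_insert_tuple k) (bigD1 i) //= [X in _ + X]big1 ?addr0.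
    rewrite mulr_sumr; apply: eq_bigr => t _; congr (_ * (_ * _)).
    rewrite (tuple_eta (permt _ _)) /= ebasisE /thead tnth_permt lift_perm_id.
    by rewrite tnth_insert_tuple_id eqxx mul1r beheadE.
  move=> a ai; rewrite big1 // => t _.
  rewrite (tuple_eta (permt _ _)) /= ebasisE /thead tnth_permt lift_perm_id.
  by rewrite tnth_insert_tuple_id eq_sym (negbTE ai) !mul0r.
rewrite exchange_big; apply: eq_bigr => t _ /=.
rewrite /annl size_tuple conjC_sum mulr_sumr; apply: eq_bigr => k _.
by rewrite val_insert_tuple conjCM conjCX conjCR; ring.
Qed.

Lemma level_inner_Lop0 v x y : H 0 (Lop v x) y = 0.
Proof. by rewrite level_inner0 mul0r. Qed.

Lemma level_inner_Rop n i x y : H n.+1 (Rop (ebasis R i) x) y = H n x (annr i y).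
Proof.
rewrite Rop_reversal -level_inner_reversal reversalK level_inner_Lop.
by rewrite -level_inner_reversal reversalK.
Qed.

End Annihilation.

(** * Norm bounds on the levels *)

Section LevelBounds.
Variables (R : realType) (d : nat) (q : R).
Hypothesis hq : -1 < q < 1.
Local Notation C := R[i].
Local Notation V := (qvec R d).
Local Notation H := (level_inner q).
Implicit Types (i j : 'I_d) (x y z : V) (w : seq 'I_d).

Definition level_normsq n x : R := complex.Re (H n x x).
Local Notation N := level_normsq.

Lemma level_normsqE n x : H n x x = (N n x)%:C.
Proof.
have := level_inner_ge0 hq n x; rewrite /N; case: (H n x x) => a b.
by rewrite lecE /= => /andP[/eqP -> _].
Qed.

Lemma level_normsq_ge0 n x : 0 <= N n x.
Proof. by have := level_inner_ge0 hq n x; rewrite level_normsqE lecR. Qed.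

Lemma level_inner_rDZ n a x y z : H n z (a *: x + y) = a^* * H n z x + H n z y.
Proof.
by rewrite -level_inner_sym level_innerDZ conjCD conjCM !level_inner_sym.
Qed.

Lemma level_inner_lZ n a x z : H n (a *: x) z = a * H n x z.
Proof.
have -> : a *: x = a *: x + 0 :> V by rewrite addr0.
rewrite level_innerDZ -[RHS]addr0; congr (_ + _).
have /(_ 1 0 0 z) := @level_innerDZ R d q n; rewrite scale1r add0r mul1r.
by move/eqP; rewrite -subr_eq subrr eq_sym => /eqP.
Qed.

Lemma level_inner_lD n x y z : H n (x + y) z = H n x z + H n y z.
Proof. by rewrite -[x]scale1r level_innerDZ mul1r scale1r. Qed.

Lemma level_inner_rZ n a x z : H n z (a *: x) = a^* * H n z x.
Proof. by rewrite -level_inner_sym level_inner_lZ conjCM level_inner_sym. Qed.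

Lemma level_inner_rD n x y z : H n z (x + y) = H n z x + H n z y.
Proof. by rewrite -level_inner_sym level_inner_lD conjCD !level_inner_sym. Qed.

Lemma Re_level_inner_sym n x y : complex.Re (H n x y) = complex.Re (H n y x).
Proof. by rewrite -level_inner_sym Re_conjC. Qed.

Lemma level_normsq_expand n (t : R) x y :
  N n (t%:C *: x + y) = t ^+ 2 * N n x + 2 * t * complex.Re (H n x y) + N n y.
Proof.
rewrite /N level_innerDZ !level_inner_rDZ conjCR mulrDr !ReD !ReZ.
by rewrite (Re_level_inner_sym n y x); ring.
Qed.

(** Expand the square norms of x + y and y - x. Unlike a product of norms, the sum on the right is
    immediately summable over the levels. *)
Lemma normr_Re_level_inner n x y : `|complex.Re (H n x y)| <= N n x + N n y.
Proof.
have h1 := level_normsq_ge0 n (1%:C *: x + y).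
have h2 := level_normsq_ge0 n ((-1)%:C *: x + y).
rewrite !level_normsq_expand in h1 h2.
have := level_normsq_ge0 n x; have := level_normsq_ge0 n y.
by rewrite ler_norml; lra.
Qed.

Lemma level_normsqZ n a x : N n (a *: x) = (complex.Re a ^+ 2 + complex.Im a ^+ 2) * N n x.
Proof.
rewrite /N level_inner_lZ level_inner_rZ mulrA level_normsqE.
by case: a => a b /=; rewrite !mulr0 subr0; ring.
Qed.

Lemma normr_Im_level_inner n x y : `|complex.Im (H n x y)| <= N n x + N n y.
Proof.
have := normr_Re_level_inner n ((0 -i* 1)%C *: x) y.
rewrite level_normsqZ /= level_inner_lZ.
have -> : complex.Re ((0 -i* 1)%C * H n x y) = complex.Im (H n x y).
  by case: (H n x y) => a b /=; rewrite mul0r mulN1r sub0r opprK.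
by rewrite sqrrN expr1n expr0n add0r mul1r.
Qed.

Lemma level_normsqD n a x y : N n (a *: x + y) <=
  2 * (complex.Re a ^+ 2 + complex.Im a ^+ 2) * N n x + 2 * N n y.
Proof.
have -> : a *: x + y = 1%:C *: (a *: x) + y by rewrite scale1r.
rewrite level_normsq_expand -(mulrA 2 _ (N n x)) -level_normsqZ.
have := level_normsq_ge0 n ((-1)%:C *: (a *: x) + y).
by rewrite level_normsq_expand; lra.
Qed.

Lemma level_normsq_reversal n x : N n (reversal x) = N n x.
Proof. by rewrite /N level_inner_reversal. Qed.

(** The sum of the geometric series in |q|, characterized by c = 1 + |q| c, which is the equation
    that closes the induction on the level. *)
Definition creation_bound : R := (1 - `|q|)^-1.
Local Notation c := creation_bound.

Let normq_lt1 : `|q| < 1. Proof. by rewrite ltr_norml. Qed.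

Lemma creation_bound_gt0 : 0 < c.
Proof. by rewrite invr_gt0 subr_gt0. Qed.

Let cE : 1 + `|q| * c = c.
Proof.
rewrite /c; have : 1 - `|q| != 0 by rewrite gt_eqF // subr_gt0.
by move=> h; field.
Qed.

(** An operator and its adjoint obey the same bound: expand the nonnegative square norm of c^-1 L_i
    z - x, where z is the annihilated vector. *)
Let annl_bound_of n i : (forall x, N n.+1 (Lop (ebasis R i) x) <= c * N n x) ->
  forall x, N n (annl q i x) <= c * N n.+1 x.
Proof.
move=> h x; set z := annl q i x.
have zE : H n.+1 (Lop (ebasis R i) z) x = (N n z)%:C.
  by rewrite level_inner_Lop level_normsqE.
have := level_normsq_ge0 n.+1 ((c^-1)%:C *: Lop (ebasis R i) z + (-1)%:C *: x).
rewrite level_normsq_expand level_inner_rZ level_normsqZ conjCR ReZ zE /=.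
have c0 := creation_bound_gt0; have ci0 : 0 < c^-1 by rewrite invr_gt0.
have := h z; set a := N n.+1 (Lop _ _); set b := N n z => ab.
rewrite expr0n addr0 sqrrN expr1n mul1r => h1.
have : c^-1 ^+ 2 * a <= c^-1 * b.
  by rewrite expr2 -mulrA; apply: ler_wpM2l; [exact/ltW | rewrite ler_pdivrMl].
by move=> h2; rewrite -ler_pdivrMl //; lra.
Qed.

(** The q-commutation relation gives |L_i x|^2 = |x|^2 + q |l_i x|^2, and the bound for l_i comes
    from creation one level below. *)
Lemma level_normsq_Lop n i x : N n.+1 (Lop (ebasis R i) x) <= c * N n x.
Proof.
have c1 : 1 <= c by rewrite -cE lerDl mulr_ge0 // ltW // creation_bound_gt0.
elim: n x => [|n IHn] x; rewrite /N level_inner_Lop annl_Lop eqxx scale1r level_inner_rD ReD -!/(N _ _).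
  rewrite level_inner_rZ -level_inner_sym level_inner_Lop0 rmorph0 mulr0 addr0.
  by rewrite ler_peMl // level_normsq_ge0.
rewrite level_inner_rZ conjCR ReZ Re_level_inner_sym level_inner_Lop -/(N _ _).
have := annl_bound_of IHn x; have := level_normsq_ge0 n (annl q i x).
move: (N n (annl q i x)) (N n.+1 x) => a b a0 ab.
rewrite -[X in _ <= X * _]cE mulrDl mul1r lerD2l -mulrA.
by apply: le_trans (ler_norm _) _; rewrite normrM; apply: ler_wpM2l; rewrite // ger0_norm.
Qed.

Lemma level_normsq_Lop0 v x : N 0 (Lop v x) = 0.
Proof. by rewrite /N level_inner_Lop0. Qed.

Lemma level_normsq_annl n i x : N n (annl q i x) <= c * N n.+1 x.
Proof. by apply: annl_bound_of => {}x; exact: level_normsq_Lop. Qed.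

End LevelBounds.

(** * The Hilbert space *)

(** Creation raises the degree by one, so the two inner product series in its adjoint relation are
    shifts of each other. *)
Lemma cvg_series_shift (R : realType) (u v : R^nat) :
  u 0%N = 0 -> (forall n, u n.+1 = v n) -> cvgn (series v) ->
  limn (series u) = limn (series v).
Proof.
move=> u0 uv cv; apply: cvg_lim => //; rewrite -cvg_shiftS.
suff -> : [sequence series u n.+1]_n = series v by [].
apply/funext => n; rewrite /series /= big_nat_recl // u0 add0r.
by apply: eq_bigr => k _; rewrite uv.
Qed.

Lemma lim_series_lin (R : realType) (a b : R) (f g h : R^nat) :
  cvgn (series f) -> cvgn (series g) -> cvgn (series h) ->
  limn (series (fun n => a * f n + b * g n + h n)) =
    a * limn (series f) + b * limn (series g) + limn (series h).
Proof.
move=> cf cg ch.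
have Zc (k : R) (u : R^nat) := @is_cvg_seriesZ _ u k.
have -> : (fun n => a * f n + b * g n + h n) = (a *: f + b *: g) + h by [].
have cfg := is_cvg_seriesD (Zc a f cf) (Zc b g cg).
by rewrite (lim_seriesD cfg ch) (lim_seriesD (Zc a f cf) (Zc b g cg)) (lim_seriesZ a cf) (lim_seriesZ b cg).
Qed.

Section FockSpace.
Variables (R : realType) (d : nat) (q : R).
Hypothesis hq : -1 < q < 1.
Local Notation C := R[i].
Local Notation V := (qvec R d).
Local Notation H := (level_inner q).
Local Notation N := (level_normsq q).
Local Notation F := (@qfock R d q).
Implicit Types (i j : 'I_d) (x y z : V) (w : seq 'I_d) (A B : V -> V).

Definition normsq x : R := limn (series (fun n => N n x)).

Let nd_partial x : {homo (series (fun n => N n x)) : n m / (n <= m)%N >-> n <= m}.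
Proof. by apply: nondecreasing_series => n _ _; exact: level_normsq_ge0. Qed.

Lemma partial_normsq_le x n : F x -> \sum_(0 <= k < n) N k x <= normsq x.
Proof. by move=> Fx; exact: (nondecreasing_cvgn_le (@nd_partial x) Fx n). Qed.

Lemma normsq_ge0 x : F x -> 0 <= normsq x.
Proof. by move=> Fx; have := partial_normsq_le 0 Fx; rewrite big_geq. Qed.

(** The extra term on the right of the hypothesis makes room for operators that lower the degree by
    one. *)
Lemma qfock_bound (K : R) x y : 0 <= K ->
  (forall n, \sum_(0 <= k < n) N k y <= K * \sum_(0 <= k < n.+1) N k x) ->
  F x -> F y /\ normsq y <= K * normsq x.
Proof.
move=> K0 h Fx; have b n : \sum_(0 <= k < n) N k y <= K * normsq x.
  by apply: le_trans (h n) _; apply: ler_wpM2l => //; exact: partial_normsq_le.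
have Fy : F y.
  apply: nondecreasing_is_cvgn; first exact: nd_partial.
  by exists (K * normsq x) => _ [n _ <-]; exact: b.
by split => //; apply: limr_le => //; apply: nearW => n; exact: b.
Qed.

Lemma level_normsq0 n : N n (0 : V) = 0.
Proof. by have := level_normsqZ hq n 0 (0 : V); rewrite scaler0 /= expr0n add0r mul0r. Qed.

Lemma qfock0 : F 0.
Proof.
have -> : F 0 = cvgn (series (fun n => N n (0 : V))) by [].
have -> : (fun n => N n (0 : V)) = 0 by apply/funext => n; rewrite level_normsq0.
have -> : series 0 = fun _ : nat => (0 : R).
  by apply/funext => n; rewrite /series /= big1.
exact: is_cvg_cst.
Qed.

Definition sq_modulus (a : C) : R := complex.Re a ^+ 2 + complex.Im a ^+ 2.
Let sq_modulus_ge0 a : 0 <= sq_modulus a. Proof. by rewrite addr_ge0 // sqr_ge0. Qed.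

Lemma qfockDZ a x y : F x -> F y ->
  F (a *: x + y) /\ normsq (a *: x + y) <= 2 * sq_modulus a * normsq x + 2 * normsq y.
Proof.
move=> Fx Fy; have b n : \sum_(0 <= k < n) N k (a *: x + y) <= 2 * sq_modulus a * normsq x + 2 * normsq y.
  apply: le_trans (_ : \sum_(0 <= k < n) (2 * sq_modulus a * N k x + 2 * N k y) <= _).
    by apply: ler_sum => k _; exact: level_normsqD.
  rewrite big_split -!mulr_sumr /=; apply: lerD; apply: ler_wpM2l;
    by rewrite ?mulr_ge0 ?partial_normsq_le.
have Fxy : F (a *: x + y).
  apply: nondecreasing_is_cvgn; first exact: nd_partial.
  by exists (2 * sq_modulus a * normsq x + 2 * normsq y) => _ [n _ <-]; exact: b.
by split => //; apply: limr_le => //; apply: nearW => n; exact: b.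
Qed.

Lemma qfockZ a x : F x -> F (a *: x).
Proof. by move=> Fx; rewrite -[_ *: _]addr0; case: (qfockDZ a Fx qfock0). Qed.

Lemma qfockD x y : F x -> F y -> F (x + y).
Proof. by move=> Fx Fy; rewrite -[x]scale1r; case: (qfockDZ 1 Fx Fy). Qed.

Lemma qfock_sum (I : Type) (r : seq I) (P : pred I) (f : I -> V) :
  (forall k, P k -> F (f k)) -> F (\sum_(k <- r | P k) f k).
Proof. by move=> h; elim/big_ind: _ => //; [exact: qfock0|exact: qfockD]. Qed.

Let cvg_dominated (f : R^nat) x y : F x -> F y ->
  (forall n, `|f n| <= N n x + N n y) -> cvgn (series f).
Proof.
move=> Fx Fy h; apply: normed_cvg.
apply: (@series_le_cvg _ _ (fun n => N n x + N n y)) => [n|n|//|].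
- exact: normr_ge0.
- by rewrite addr_ge0 // level_normsq_ge0.
exact: (is_cvg_seriesD Fx Fy).
Qed.

Lemma cvg_Re_inner x y : F x -> F y -> cvgn (series (fun n => complex.Re (H n x y))).
Proof.
by move=> Fx Fy; apply: (cvg_dominated Fx Fy) => n; exact: normr_Re_level_inner.
Qed.

Lemma cvg_Im_inner x y : F x -> F y -> cvgn (series (fun n => complex.Im (H n x y))).
Proof.
by move=> Fx Fy; apply: (cvg_dominated Fx Fy) => n; exact: normr_Im_level_inner.
Qed.

Let complexP (a b : C) : complex.Re a = complex.Re b -> complex.Im a = complex.Im b -> a = b.
Proof. by case: a b => [a a'] [b b'] /= -> ->. Qed.

Lemma qinnerDZ a x y z : F x -> F y -> F z ->
  qinner q (a *: x + y) z = a * qinner q x z + qinner q y z.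
Proof.
move=> Fx Fy Fz; have [rx ix ry iy] := And4 (cvg_Re_inner Fx Fz) (cvg_Im_inner Fx Fz)
  (cvg_Re_inner Fy Fz) (cvg_Im_inner Fy Fz).
case: a => a b; apply: complexP => /=; rewrite -?mulNr -lim_series_lin //;
  congr (limn (series _)); apply/funext => n; rewrite level_innerDZ.
- by case: (H n x z) => c e /=; rewrite ReD /= mulNr.
- by case: (H n x z) => c e /=; rewrite ImD /=.
Qed.

Lemma qinner_sym x y : F x -> F y -> (qinner q x y)^* = qinner q y x.
Proof.
move=> Fx Fy; rewrite /qinner; apply: complexP; rewrite ?Re_conjC ?Im_conjC /=.
  congr (limn (series _)); apply/funext => n; exact: Re_level_inner_sym.
rewrite -lim_seriesN; last exact: cvg_Im_inner.
congr (limn (series _)); apply/funext => n /=.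
by rewrite -[in RHS]level_inner_sym Im_conjC.
Qed.

Lemma qinner_lD x y z : F x -> F y -> F z ->
  qinner q (x + y) z = qinner q x z + qinner q y z.
Proof. by move=> *; rewrite -[x]scale1r qinnerDZ // mul1r scale1r. Qed.

Lemma qinner_l0 z : F z -> qinner q 0 z = 0.
Proof.
move=> Fz; have /eqP := qinnerDZ 1 qfock0 qfock0 Fz.
by rewrite scaler0 addr0 mul1r -subr_eq subrr eq_sym => /eqP.
Qed.

Lemma qinner_lZ a x z : F x -> F z -> qinner q (a *: x) z = a * qinner q x z.
Proof.
by move=> Fx Fz; rewrite -[a *: x]addr0 qinnerDZ //; [rewrite qinner_l0 // addr0|exact: qfock0].
Qed.

Lemma qinner_lsum (I : Type) (r : seq I) (P : pred I) (f : I -> V) z :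
  (forall k, P k -> F (f k)) -> F z ->
  qinner q (\sum_(k <- r | P k) f k) z = \sum_(k <- r | P k) qinner q (f k) z.
Proof.
move=> h Fz.
suff [] : F (\sum_(k <- r | P k) f k) /\
   qinner q (\sum_(k <- r | P k) f k) z = \sum_(k <- r | P k) qinner q (f k) z by [].
elim/big_ind2: _ => [|x a y b [Fx <-] [Fy <-]|k Pk].
- by split; [exact: qfock0|exact: qinner_l0].
- by split; [exact: qfockD|exact: qinner_lD].
- by split => //; exact: h.
Qed.

Lemma qinner_rD x y z : F x -> F y -> F z ->
  qinner q z (x + y) = qinner q z x + qinner q z y.
Proof.
move=> Fx Fy Fz; have Fxy := qfockD Fx Fy.
by rewrite -qinner_sym // qinner_lD // conjCD !qinner_sym.
Qed.

Lemma qinner_rZ a x z : F x -> F z -> qinner q z (a *: x) = a^* * qinner q z x.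
Proof.
move=> Fx Fz; have Fax : F (a *: x) by exact: qfockZ.
by rewrite -qinner_sym // qinner_lZ // conjCM !qinner_sym.
Qed.

Lemma qfockN x : F x -> F (- x).
Proof. by rewrite -scaleN1r; exact: qfockZ. Qed.

Lemma qinner_rN x z : F x -> F z -> qinner q z (- x) = - qinner q z x.
Proof.
move=> Fx Fz; rewrite -scaleN1r qinner_rZ // (_ : (-1)^* = -1) ?mulN1r //.
by rewrite rmorphN rmorph1.
Qed.

Lemma qinner_rsum (I : Type) (r : seq I) (P : pred I) (f : I -> V) z :
  (forall k, P k -> F (f k)) -> F z ->
  qinner q z (\sum_(k <- r | P k) f k) = \sum_(k <- r | P k) qinner q z (f k).
Proof.
move=> h Fz; rewrite -qinner_sym //; last exact: qfock_sum.
by rewrite qinner_lsum // conjC_sum; apply: eq_bigr => k Pk; rewrite qinner_sym //; exact: h.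
Qed.

Lemma qinner_normsq x : qinner q x x = (normsq x)%:C.
Proof.
apply: complexP => //=.
have -> : (fun n => complex.Im (H n x x)) = fun=> 0.
  by apply/funext => n; rewrite level_normsqE.
by apply: cvg_lim => //; rewrite /series /=; under eq_fun do rewrite big1 //; exact: cvg_cst.
Qed.

Lemma qnormE x : qnorm q x = Num.sqrt (normsq x).
Proof. by rewrite /qnorm qinner_normsq. Qed.

Lemma normsq_eq0 x : F x -> normsq x = 0 -> x = 0.
Proof.
move=> Fx x0; apply/funext => w; apply: (level_inner_eq0 hq (n := size w)) => //.
rewrite level_normsqE //; apply: (congr1 (fun r : R => r%:C)); apply/eqP.
rewrite eq_le level_normsq_ge0 // andbT -x0.
apply: le_trans (partial_normsq_le (size w).+1 Fx).
by rewrite big_nat_recr //= lerDr sumr_ge0 // => k _; exact: level_normsq_ge0.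
Qed.

Lemma qfock_ext x y : F x -> F y ->
  (forall z, F z -> qinner q z x = qinner q z y) -> x = y.
Proof.
move=> Fx Fy h; apply/eqP; rewrite -subr_eq0; apply/eqP.
have FyN := qfockN Fy.
have Fxy : F (x - y) by exact: qfockD.
apply: normsq_eq0 => //; suff : (normsq (x - y))%:C = 0 by move/(congr1 (@complex.Re R)).
by rewrite -qinner_normsq qinner_rD // qinner_rN // h // subrr.
Qed.

(** The constant bounds square norms, which add up over the levels; its sign is recorded so that
    bounds can be multiplied. *)
Definition fock_bounded A : Prop :=
  [/\ forall x, F x -> F (A x),
      forall (a : C) x y, F x -> F y -> A (a *: x + y) = a *: A x + A y &
      exists2 K : R, 0 <= K & forall x, F x -> normsq (A x) <= K * normsq x].

Lemma fock_bounded_operator A : fock_bounded A -> bounded_operator q A.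
Proof.
move=> [FA linA [K K0 bA]]; split => //; exists (Num.sqrt K) => x Fx.
by rewrite !qnormE -sqrtrM // ler_sqrt ?bA // mulr_ge0 // normsq_ge0.
Qed.

Lemma fock_bounded_comp A B : fock_bounded A -> fock_bounded B -> fock_bounded (A \o B).
Proof.
move=> [FA lA [K K0 bA]] [FB lB [L L0 bB]]; split => [x Fx|a x y Fx Fy|] /=.
- exact/FA/FB.
- by rewrite lB // lA //; exact: FB.
- exists (K * L) => [|x Fx /=]; first exact: mulr_ge0.
  apply: le_trans (bA _ (FB _ Fx)) _; rewrite -mulrA; apply: ler_wpM2l => //; exact: bB.
Qed.

Lemma fock_boundedD A B : fock_bounded A -> fock_bounded B -> fock_bounded (A \+ B).
Proof.
move=> [FA lA [K K0 bA]] [FB lB [L L0 bB]]; split => [x Fx|a x y Fx Fy|] /=.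
- by apply: qfockD; [exact: FA|exact: FB].
- by rewrite lB // lA // scalerDr addrACA.
- exists (2 * K + 2 * L) => [|x Fx /=]; first by rewrite addr_ge0 // mulr_ge0.
  have [_] := qfockDZ 1 (FA _ Fx) (FB _ Fx); rewrite scale1r => /le_trans; apply.
  have -> : sq_modulus 1 = 1 by rewrite /sq_modulus /= expr1n expr0n addr0.
  rewrite mulr1 [leRHS]mulrDl -!mulrA.
  by apply: lerD; apply: ler_wpM2l => //; [exact: bA|exact: bB].
Qed.

Lemma fock_bounded_sum (I : Type) (r : seq I) (A : I -> V -> V) :
  (forall k, fock_bounded (A k)) -> fock_bounded (fun x => \sum_(k <- r) A k x).
Proof.
move=> bA; elim: r => [|k r IHr].
  split => [x _|a x y _ _|]; rewrite ?big_nil ?scaler0 ?addr0 //; first exact: qfock0.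
  exists 0 => // x Fx; rewrite big_nil mul0r /normsq.
  have -> : (fun n => N n (0 : V)) = fun=> 0 by apply/funext => n; rewrite level_normsq0.
  rewrite (_ : limn _ = 0) //; apply: cvg_lim => //.
  by rewrite /series /=; under eq_fun do rewrite big1 //; exact: cvg_cst.
have -> : (fun x => \sum_(l <- k :: r) A l x) = A k \+ (fun x => \sum_(l <- r) A l x).
  by apply/funext => x; rewrite big_cons.
exact: fock_boundedD.
Qed.

Lemma is_adjoint_sym A B : fock_bounded A -> fock_bounded B ->
  is_adjoint q A B -> is_adjoint q B A.
Proof.
move=> [FA _ _] [FB _ _] h x y Fx Fy.
have [FAy FBx] := conj (FA _ Fy) (FB _ Fx).
by rewrite -qinner_sym // -h // qinner_sym.
Qed.

Lemma is_adjointD A A' B B' : fock_bounded A -> fock_bounded A' ->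
  fock_bounded B -> fock_bounded B' ->
  is_adjoint q A B -> is_adjoint q A' B' -> is_adjoint q (A \+ A') (B \+ B').
Proof.
move=> [FA _ _] [FA' _ _] [FB _ _] [FB' _ _] h h' x y Fx Fy /=.
have [a a' b b'] := And4 (FA _ Fx) (FA' _ Fx) (FB _ Fy) (FB' _ Fy).
by rewrite qinner_lD // qinner_rD // h // h'.
Qed.

(** B shows that the set behind [xget] is inhabited, so the chosen map is an adjoint too, and
    definiteness of the inner product identifies the two on the Fock space. *)
Lemma adjointE A B y : fock_bounded B -> is_adjoint q A B -> F y -> adjoint q A y = B y.
Proof.
move=> bB hB Fy.
have [[FB' _ _] hB'] : [set B | bounded_operator q B /\ is_adjoint q A B] (adjoint q A).
  by apply: xgetPex; exists B; split => //; exact: fock_bounded_operator.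
have [FB _ _] := bB.
by apply: qfock_ext => [||z Fz]; [exact: FB'|exact: FB|rewrite -hB' // -hB].
Qed.

Lemma fock_bounded_level (K : R) A : 0 <= K ->
  (forall n x, \sum_(0 <= k < n) N k (A x) <= K * \sum_(0 <= k < n.+1) N k x) ->
  (forall a x y, A (a *: x + y) = a *: A x + A y) -> fock_bounded A.
Proof.
move=> K0 bA linA; split => [x Fx|a x y _ _|].
- by have [] := qfock_bound K0 (fun n => bA n x) Fx.
- exact: linA.
- by exists K => // x Fx; have [] := qfock_bound K0 (fun n => bA n x) Fx.
Qed.

Let c0 : 0 <= creation_bound q. Proof. exact/ltW/creation_bound_gt0. Qed.

Let sum_shift_le n x : \sum_(0 <= k < n) N k.+1 x <= \sum_(0 <= k < n.+1) N k x.
Proof. by rewrite [leRHS]big_nat_recl // lerDr level_normsq_ge0. Qed.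

Lemma fock_bounded_Lop i : fock_bounded (Lop (ebasis R i)).
Proof.
apply: (fock_bounded_level c0) => [[|n] x|a x y].
- by rewrite big_geq // mulr_ge0 // sumr_ge0 // => k _; exact: level_normsq_ge0.
- rewrite big_nat_recl // level_normsq_Lop0 add0r.
  apply: le_trans (_ : creation_bound q * \sum_(0 <= k < n) N k x <= _).
    by rewrite mulr_sumr; apply: ler_sum => k _; exact: level_normsq_Lop.
  apply: ler_wpM2l => //; rewrite !big_nat_recr //= -addrA lerDl.
  by rewrite addr_ge0 // level_normsq_ge0.
- apply/funext => -[|b w] /=.
    by rewrite -[RHS]/(a * 0 + 0) mulr0 addr0.
  rewrite -[RHS]/(a * (_ * _) + _ * _) -[(a *: x + y) w]/(a * x w + y w); ring.
Qed.

Lemma fock_bounded_annl i : fock_bounded (annl q i).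
Proof.
apply: (fock_bounded_level c0) => [n x|a x y].
- apply: le_trans (ler_wpM2l c0 (sum_shift_le n x)).
  by rewrite mulr_sumr; apply: ler_sum => k _; exact: level_normsq_annl.
- apply/funext => w; rewrite -[RHS]/(a * annl q i x w + annl q i y w) /annl.
  rewrite mulr_sumr -big_split; apply: eq_bigr => k _ /=.
  rewrite -[(a *: x + y) _]/(a * x _ + y _); ring.
Qed.

Lemma fock_bounded_reversal : fock_bounded (@reversal R d).
Proof.
apply: (fock_bounded_level ler01) => [n x|a x y //].
rewrite mul1r; under eq_bigr do rewrite level_normsq_reversal.
by rewrite [leRHS]big_nat_recr //= lerDl level_normsq_ge0.
Qed.

Lemma fock_bounded_Rop i : fock_bounded (Rop (ebasis R i)).
Proof.
have -> : Rop (ebasis R i) = @reversal R d \o Lop (ebasis R i) \o @reversal R d.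
  by apply/funext => x; rewrite Rop_reversal.
have br := fock_bounded_reversal.
exact: fock_bounded_comp (fock_bounded_comp br (fock_bounded_Lop i)) br.
Qed.

Lemma fock_bounded_annr i : fock_bounded (annr q i).
Proof.
have br := fock_bounded_reversal.
exact: fock_bounded_comp br (fock_bounded_comp (fock_bounded_annl i) br).
Qed.

Lemma is_adjoint_Lop i : is_adjoint q (Lop (ebasis R i)) (annl q i).
Proof.
move=> x y Fx Fy; have [Fl _ _] := fock_bounded_annl i; have Fay := Fl y Fy.
rewrite /qinner; congr (_ +i* _)%C; apply: cvg_series_shift.
- by rewrite level_inner_Lop0.
- by move=> n; rewrite level_inner_Lop.
- exact: cvg_Re_inner.
- by rewrite level_inner_Lop0.
- by move=> n; rewrite level_inner_Lop.
- exact: cvg_Im_inner.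
Qed.

Lemma is_adjoint_Rop i : is_adjoint q (Rop (ebasis R i)) (annr q i).
Proof.
have [Fr _ _] := fock_bounded_reversal.
have rr x y : qinner q (reversal x) (reversal y) = qinner q x y.
  by rewrite /qinner; congr (limn (series _) +i* limn (series _))%C;
    apply/funext => n; rewrite level_inner_reversal.
move=> x y Fx Fy; rewrite Rop_reversal -rr reversalK is_adjoint_Lop //; try exact: Fr.
by rewrite -rr reversalK.
Qed.

End FockSpace.

(** * Field operators *)

Section FieldOperators.
Variables (R : realType) (d : nat) (q : R).
Hypothesis hq : -1 < q < 1.
Local Notation C := R[i].
Local Notation V := (qvec R d).
Local Notation H := (level_inner q).
Local Notation F := (@qfock R d q).
Implicit Types (i j : 'I_d) (x y z : V) (w : seq 'I_d) (A B : V -> V).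

(** [Xop], [Yop] and [XYsum] are choice-free versions of [Lsum], [Rsum] and [Top], additive on all
    coordinate families and not only on square-summable ones. *)
Definition Xop i : V -> V := Lop (ebasis R i) \+ annl q i.
Definition Yop i : V -> V := Rop (ebasis R i) \+ annr q i.
Definition XYsum x : V := \sum_i Xop i (Yop i x).

Lemma LopD v x y : Lop v (x + y) = Lop v x + Lop v y.
Proof.
by apply/funext => -[|a w] /=; [rewrite -[RHS]/(0 + 0) addr0|rewrite -[RHS]/(_ * _ + _ * _) -mulrDr].
Qed.

Lemma annlD i x y : annl q i (x + y) = annl q i x + annl q i y.
Proof.
apply/funext => w; rewrite -[RHS]/(annl q i x w + annl q i y w) /annl -big_split.
by apply: eq_bigr => k _ /=; rewrite -mulrDr.
Qed.

Lemma XopD i x y : Xop i (x + y) = Xop i x + Xop i y.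
Proof. by rewrite /Xop /= LopD annlD addrACA. Qed.

Lemma RopD v x y : Rop v (x + y) = Rop v x + Rop v y.
Proof. by rewrite !Rop_reversal -[reversal (x + y)]/(reversal x + reversal y) LopD. Qed.

Lemma annrD i x y : annr q i (x + y) = annr q i x + annr q i y.
Proof. by rewrite /annr -[reversal (x + y)]/(reversal x + reversal y) annlD. Qed.

Lemma YopD i x y : Yop i (x + y) = Yop i x + Yop i y.
Proof. by rewrite /Yop /= RopD annrD addrACA. Qed.

Let additive_sum A (I : Type) (r : seq I) (f : I -> V) :
  (forall x y, A (x + y) = A x + A y) -> A (\sum_(k <- r) f k) = \sum_(k <- r) A (f k).
Proof.
move=> AD; have A0 : A 0 = 0.
  by apply: (addrI (A 0)); rewrite -AD !addr0.
exact: (big_morph A AD A0).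
Qed.

Lemma XYsum_sum (I : Type) (r : seq I) (f : I -> V) :
  XYsum (\sum_(k <- r) f k) = \sum_(k <- r) XYsum (f k).
Proof.
apply: additive_sum => x y; rewrite /XYsum -big_split.
by apply: eq_bigr => i _ /=; rewrite YopD XopD.
Qed.

(** On each level the difference is orthogonal to every vector, because left and right creation
    commute; the form of the level is definite. *)
Lemma annl_annr i j x : annl q i (annr q j x) = annr q j (annl q i x).
Proof.
apply/eqP; rewrite -subr_eq0; apply/eqP; set D : V := _ - _.
have ort n z : H n z D = 0.
  rewrite /D -scaleN1r addrC level_inner_rDZ -!level_inner_Lop -!level_inner_Rop.
  by rewrite -level_inner_Lop Lop_Rop rmorphN rmorph1 mulN1r addrC subrr.
by apply/funext => w; exact: (level_inner_eq0 hq (ort (size w) D)).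
Qed.

(* The two mixed commutators are [delta_ij q^N] and [- delta_ij q^N], where [N]
   is the number operator. *)
Lemma Xop_Yop i j x : Xop i (Yop j x) = Yop j (Xop i x).
Proof.
rewrite /Xop /Yop /= LopD annlD RopD annrD annl_annr annl_Rop annr_Lop Lop_Rop eq_sym.
rewrite -!addrA; congr (_ + _); rewrite addrCA [RHS]addrCA; congr (_ + _).
exact: addrCA.
Qed.

Lemma LsumE i x : F x -> Lsum q i x = Xop i x.
Proof.
move=> Fx; rewrite /Lsum /Xop /=; congr (_ + _).
by apply: (adjointE hq) => //; [exact: fock_bounded_annl|exact: is_adjoint_Lop].
Qed.

Lemma RsumE i x : F x -> Rsum q i x = Yop i x.
Proof.
move=> Fx; rewrite /Rsum /Yop /=; congr (_ + _).
by apply: (adjointE hq) => //; [exact: fock_bounded_annr|exact: is_adjoint_Rop].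
Qed.

Lemma fock_bounded_Xop i : fock_bounded q (Xop i).
Proof. exact: (fock_boundedD hq (fock_bounded_Lop hq i) (fock_bounded_annl hq i)). Qed.

Lemma fock_bounded_Yop i : fock_bounded q (Yop i).
Proof. exact: (fock_boundedD hq (fock_bounded_Rop hq i) (fock_bounded_annr hq i)). Qed.

Lemma fock_bounded_XYsum : fock_bounded q XYsum.
Proof.
apply: (@fock_bounded_sum _ _ _ hq _ _ (fun i => Xop i \o Yop i)) => i.
by apply: fock_bounded_comp; [exact: fock_bounded_Xop|exact: fock_bounded_Yop].
Qed.

Lemma selfadjoint_Xop i : is_adjoint q (Xop i) (Xop i).
Proof.
have [bL bA] := conj (fock_bounded_Lop hq i) (fock_bounded_annl hq i).
have h := @is_adjoint_Lop R d q hq i.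
have e : Xop i = annl q i \+ Lop (ebasis R i) by apply/funext => x; exact: addrC.
by rewrite {2}e; apply: is_adjointD => //; exact: is_adjoint_sym.
Qed.

Lemma selfadjoint_Yop i : is_adjoint q (Yop i) (Yop i).
Proof.
have [bL bA] := conj (fock_bounded_Rop hq i) (fock_bounded_annr hq i).
have h := @is_adjoint_Rop R d q hq i.
have e : Yop i = annr q i \+ Rop (ebasis R i) by apply/funext => x; exact: addrC.
by rewrite {2}e; apply: is_adjointD => //; exact: is_adjoint_sym.
Qed.

(** The adjoint of X_i Y_i is Y_i X_i, which is X_i Y_i again by commutation. *)
Lemma selfadjoint_XYsum : is_adjoint q XYsum XYsum.
Proof.
move=> x y Fx Fy.
have FX i z : F z -> F (Xop i z) by case: (fock_bounded_Xop i) => + _ _; apply.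
have FY i z : F z -> F (Yop i z) by case: (fock_bounded_Yop i) => + _ _; apply.
rewrite qinner_lsum ?qinner_rsum // => [|k _|k _]; try by apply: FX; apply: FY.
apply: eq_bigr => i _; rewrite selfadjoint_Xop //; last exact: FY.
by rewrite selfadjoint_Yop ?Xop_Yop //; exact: FX.
Qed.

Lemma TopE x : F x -> Top d q x = XYsum x.
Proof.
move=> Fx; rewrite /Top /XYsum; apply: eq_bigr => i _; rewrite RsumE // LsumE //.
by case: (fock_bounded_Yop i) => + _ _; apply.
Qed.

Lemma fock_bounded_Top : fock_bounded q (Top d q).
Proof.
have [FT lT [K K0 bT]] := fock_bounded_XYsum.
split => [x Fx|a x y Fx Fy|]; first by rewrite TopE //; exact: FT.
  by rewrite !TopE ?lT //; have [] := qfockDZ hq a Fx Fy.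
by exists K => // x Fx; rewrite TopE //; exact: bT.
Qed.

Lemma selfadjoint_Top : selfadjoint q (Top d q).
Proof. by move=> x y Fx Fy; rewrite !TopE //; exact: selfadjoint_XYsum. Qed.

Lemma level_inner_vacuum n x : H n.+1 x (@vacuum R d) = 0.
Proof.
rewrite (eq_level_inner q (x' := x) (y' := 0 *: x)) // => [|w sw].
  by rewrite level_inner_rZ rmorph0 mul0r.
by rewrite /vacuum -size_eq0 sw -[RHS]/(0 * _) mul0r.
Qed.

Let cvg_vacuum x (f : C -> R) : f 0 = 0 ->
  series (fun n => f (H n x (@vacuum R d))) @ \oo --> f (x [::]).
Proof.
move=> f0; rewrite -cvg_shiftS.
suff -> : [sequence series (fun n => f (H n x (@vacuum R d))) n.+1]_n = fun=> f (x [::]).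
  exact: cvg_cst.
apply/funext => n; rewrite /series /= big_nat_recl // big1 => [|k _].
  by rewrite level_inner0 /vacuum eqxx rmorph1 mulr1 addr0.
by rewrite level_inner_vacuum f0.
Qed.

Lemma qinner_vacuum x : qinner q x (@vacuum R d) = x [::].
Proof.
have cv (f : C -> R) : f 0 = 0 -> limn (series (fun n => f (H n x (@vacuum R d)))) = f (x [::]).
  by move=> f0; apply: cvg_lim => //; exact: cvg_vacuum.
by rewrite /qinner !cv //; case: (x [::]).
Qed.

Lemma qfock_vacuum : F (@vacuum R d).
Proof. by apply/cvg_ex; exists (complex.Re (@vacuum R d [::])); exact: cvg_vacuum. Qed.

Definition Xword w : V := foldr Xop (@vacuum R d) w.

Lemma annl_vacuum i : annl q i (@vacuum R d) = 0.
Proof.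
apply/funext => w; rewrite /annl big1 // => k _.
by rewrite /vacuum -size_eq0 size_cat /= addnS mulr0.
Qed.

Lemma Yop_vacuum i : Yop i (@vacuum R d) = Xop i (@vacuum R d).
Proof.
have vr : reversal (@vacuum R d) = @vacuum R d.
  by apply/funext => w; rewrite /reversal /vacuum -!size_eq0 size_rev.
rewrite /Xop /Yop /= annl_vacuum /annr vr annl_vacuum; congr (_ + _).
by apply/funext => -[|a [|b w]] //=; rewrite ?mulr0 ?mul0r // mulrC.
Qed.

Lemma Yop_Xword i w : Yop i (Xword w) = Xword (rcons w i).
Proof. by elim: w => [|a w IHw] /=; [exact: Yop_vacuum|rewrite -IHw Xop_Yop]. Qed.

Lemma iter_Top_vacuum n :
  iter n (Top d q) (@vacuum R d) = \sum_(t : n.-tuple 'I_d) Xword (t ++ rev t).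
Proof.
have FT m : F (iter m (Top d q) (@vacuum R d)).
  elim: m => [|m IHm]; first exact: qfock_vacuum.
  by case: fock_bounded_Top => + _ _; apply.
elim: n => [|n IHn].
  rewrite (bigD1 [tuple]) //= big1 ?addr0 // => t.
  by rewrite [t]tuple0 => /eqP.
rewrite iterS TopE // IHn XYsum_sum (big_insert_tuple ord0) [RHS]exchange_big.
apply: eq_bigr => t _; apply: eq_bigr => i _.
rewrite Yop_Xword val_insert_tuple take0 drop0 /=; congr (Xop i (Xword _)).
by rewrite rev_cons rcons_cat.
Qed.

Lemma vacuum_moment n : vacuum_state q (fun x => iter n (Top d q) x) =
  \sum_(t : n.-tuple 'I_d) Xword (t ++ rev t) [::].
Proof.
rewrite /vacuum_state qinner_vacuum iter_Top_vacuum.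
by apply: (big_ind2 (fun (x : V) (a : C) => x [::] = a)) => // x a y b <- <-.
Qed.

End FieldOperators.

(** * The q-Wick formula *)

Section Involutions.

(** A partial pairing is encoded as an involution whose fixed points are the points left
    unpaired. *)
Definition involution m (s : 'S_m) : bool := [forall i, s (s i) == i].

Definition fixpoints m (s : 'S_m) : seq 'I_m := [seq j <- enum 'I_m | s j == j].

(* Crossings of two pairs [a < b < s a < s b], together with the fixed points
   [b] covered by a pair [a < b < s a]. *)
Definition crossing_weight m (s : 'S_m) : nat :=
  \sum_(a < m) \sum_(b < m) [&& a < b, b < s a & (s a < s b) || (s b == b)]%N.

(** If s is an involution fixing k, this pairs the new point 0 with k. For other s it only serves to
    exhaust the permutations in [big_perm_join]. *)
Definition join0 m (k : 'I_m) (s : 'S_m) : 'S_m.+1 :=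
  (lift_perm ord0 ord0 s * tperm ord0 (lift ord0 k))%g.

Lemma join0_0 m k (s : 'S_m) : join0 k s ord0 = lift ord0 k.
Proof. by rewrite permM lift_perm_id tpermL. Qed.

Lemma join0_lift m k (s : 'S_m) i : s i != k -> join0 k s (lift ord0 i) = lift ord0 (s i).
Proof.
move=> sik; rewrite permM lift_perm_lift tpermD //.
by rewrite (inj_eq (@lift_inj _ _)) eq_sym.
Qed.

Lemma join0_k m k (s : 'S_m) i : s i = k -> join0 k s (lift ord0 i) = ord0.
Proof. by move=> <-; rewrite permM lift_perm_lift tpermR. Qed.

(** The value at 0 separates the cases, and a transposition reduces a nonzero value to the value 0.
    The cardinalities agree, so injectivity of the parametrization suffices. *)
Lemma big_perm_join (R : nmodType) m (F : 'S_m.+1 -> R) :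
  \sum_u F u = \sum_s F (lift_perm ord0 ord0 s) + \sum_s \sum_k F (join0 k s).
Proof.
pose f (p : 'I_m.+1 * 'S_m) : 'S_m.+1 :=
  if unlift ord0 p.1 is Some k then join0 k p.2 else lift_perm ord0 ord0 p.2.
have f0 p : f p ord0 = p.1.
  by case: p => b s; rewrite /f /=; case: unliftP => [k|] ->; rewrite ?join0_0 ?lift_perm_id.
have fi : injective f.
  move=> [b s] [b' s'] e; have := f_equal (fun u : 'S_m.+1 => u ord0) e; rewrite !f0 /= => bb'.
  rewrite -bb' in e *; congr (_, _).
  have li (t t' : 'S_m) : lift_perm ord0 ord0 t = lift_perm ord0 ord0 t' -> t = t'.
    move=> tt'; apply/permP => i; apply: (@lift_inj _ ord0).
    by rewrite -!(lift_perm_lift ord0) tt'.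
  by move: e; rewrite /f /=; case: unlift => [k|] => [/mulIg/li|/li].
rewrite (reindex f) /=; last first.
  by apply: onW_bij; apply: inj_card_bij => //; rewrite card_prod !card_Sn card_ord factS.
rewrite -(pair_bigA _ (fun b s => F (f (b, s)))) /= big_ord_recl; congr (_ + _).
  by apply: eq_bigr => s _; rewrite /f unlift_none.
rewrite exchange_big; apply: eq_bigr => s _; apply: eq_bigr => k _.
by rewrite /f liftK.
Qed.

Lemma involution_lift m (s : 'S_m) : involution (lift_perm ord0 ord0 s) = involution s.
Proof.
apply/forallP/forallP => h i.
  have := h (lift ord0 i); rewrite !lift_perm_lift; by rewrite (inj_eq (@lift_inj _ _)).
by case: (unliftP ord0 i) => [j|] ->; rewrite ?lift_perm_lift ?(eqP (h j)) ?lift_perm_id.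
Qed.

Lemma involution_join m k (s : 'S_m) : involution (join0 k s) = involution s && (s k == k).
Proof.
apply/forallP/andP => [h|[/forallP h /eqP sk] i].
  have /eqP sk : s k == k.
    have := h ord0; rewrite join0_0; case: (eqVneq (s k) k) => // sk.
    by rewrite join0_lift.
  split; last exact/eqP.
  apply/forallP => i; case: (eqVneq i k) => [->|ik]; first by rewrite !sk.
  have sik : s i != k by rewrite -sk (inj_eq perm_inj).
  have ssik : s (s i) != k by rewrite -sk (inj_eq perm_inj).
  by have := h (lift ord0 i); rewrite !join0_lift // (inj_eq (@lift_inj _ _)).
case: (unliftP ord0 i) => [j|] ->; last by rewrite join0_0 join0_k.
case: (eqVneq j k) => [->|jk]; first by rewrite join0_k // join0_0.
have sjk : s j != k by rewrite -sk (inj_eq perm_inj).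
have ssjk : s (s j) != k by rewrite -sk (inj_eq perm_inj).
by rewrite !join0_lift // (eqP (h j)).
Qed.

Lemma fixpoints_lift m (s : 'S_m) :
  fixpoints (lift_perm ord0 ord0 s) = ord0 :: map (lift ord0) (fixpoints s).
Proof.
rewrite /fixpoints enum_ordSl /= lift_perm_id eqxx filter_map; congr (_ :: map _ _).
by apply: eq_filter => j /=; rewrite lift_perm_lift (inj_eq (@lift_inj _ _)).
Qed.

Lemma fixpoints_join m k (s : 'S_m) : s k = k ->
  fixpoints (join0 k s) = map (lift ord0) (rem k (fixpoints s)).
Proof.
move=> sk; rewrite /fixpoints enum_ordSl /= join0_0.
have /negbTE -> : lift ord0 k != ord0 by rewrite eq_sym neq_lift.
have ue : uniq [seq j <- enum 'I_m | s j == j] by apply: filter_uniq; exact: enum_uniq.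
rewrite filter_map (rem_filter _ ue) -[X in _ = map _ X]filter_predI; congr (map _ _).
apply: eq_filter => j /=; case: (eqVneq j k) => [->|jk] /=.
  by rewrite join0_k // neq_lift.
by rewrite join0_lift ?(inj_eq (@lift_inj _ _)) // -sk (inj_eq perm_inj).
Qed.

Lemma crossing_weight_lift m (s : 'S_m) :
  crossing_weight (lift_perm ord0 ord0 s) = crossing_weight s.
Proof.
rewrite /crossing_weight big_ord_recl big1 ?add0n; last first.
  by move=> b _; rewrite lift_perm_id; case: b => -[].
apply: eq_bigr => a _; rewrite big_ord_recl /= add0n; apply: eq_bigr => b _.
by rewrite !lift_perm_lift (inj_eq (@lift_inj _ _)) /= /bump !leq0n !add1n !ltnS.
Qed.

(** The new pair {0, k} crosses the pairs around k and covers the fixed points before k. The former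
    were already counted in s, as pairs covering the fixed point k, so only the latter are new. *)
Lemma crossing_weight_join m k (s : 'S_m) : s k = k ->
  crossing_weight (join0 k s) = (crossing_weight s + \sum_(j < m) ((j < k) && (s j == j)))%N.
Proof.
move=> sk.
have sN j : j != k -> s j != k by move=> jk; rewrite -sk (inj_eq perm_inj).
have row0 : (\sum_(b < m.+1) [&& (ord0 : 'I_m.+1) < b, b < join0 k s ord0 &
    (join0 k s ord0 < join0 k s b) || (join0 k s b == b)] =
    \sum_(i < m) ((i < k) && (k < s i)) + \sum_(j < m) ((j < k) && (s j == j)))%N.
  rewrite big_ord_recl /= add0n -big_split /=; apply: eq_bigr => j _.
  rewrite join0_0 /= /bump !leq0n !add1n !ltnS.
  case: (eqVneq j k) => [->|jk]; first by rewrite ltnn.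
  rewrite join0_lift ?sN // (inj_eq (@lift_inj _ _)) /= /bump leq0n add1n ltnS.
  case: (ltnP j k) => //= jk'; case: eqP => [->|_]; last by rewrite orbF addn0.
  by rewrite ltnNge (ltnW jk').
rewrite {1}/crossing_weight big_ord_recl row0 addnAC; congr (_ + _)%N.
rewrite /crossing_weight -big_split /=; apply: eq_bigr => i _.
rewrite big_ord_recl /= add0n.
case: (eqVneq i k) => [->|ik].
  rewrite ltnn /= add0n big1 => [|b _]; last by rewrite join0_k // ltn0 andbF.
  by rewrite big1 // => b _; rewrite sk; case: ltngtP.
rewrite join0_lift ?sN // (bigD1 k) //= [RHS](bigD1 k) //= sk eqxx orbT andbT.
rewrite join0_k //= /bump !leq0n !add1n !ltnS ?ltn0 /= ?andbF ?add0n; congr (_ + _)%N.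
by apply: eq_bigr => j jk; rewrite join0_lift ?sN // (inj_eq (@lift_inj _ _)).
Qed.

(** The left side is the exponent of q paid by [annl] to contract the letter k, the right side the
    increase of [crossing_weight]. *)
Lemma index_fixpoints m (s : 'S_m) k : s k = k ->
  index k (fixpoints s) = (\sum_(j < m) ((j < k) && (s j == j)))%N.
Proof.
move=> sk; have srt : sorted (fun i j : 'I_m => (i < j)%N) (fixpoints s).
  apply: sorted_filter => [x y z|]; first exact: ltn_trans.
  by have := iota_ltn_sorted 0 m; rewrite -val_enum_ord sorted_map.
have -> : (\sum_(j < m) ((j < k) && (s j == j)) = count (fun j : 'I_m => (j < k)%N) (fixpoints s))%N.
  rewrite /fixpoints count_filter -sum1_count big_enum_cond /= big_mkcond [RHS]big_mkcond /=.
  by apply: eq_bigr => j _; case: (_ && _).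
have : k \in fixpoints s by rewrite mem_filter sk eqxx mem_enum.
elim: (fixpoints s) srt => //= x r IHr srt.
have xr : all (fun j : 'I_m => (x < j)%N) r.
  by apply: order_path_min srt => a b c; exact: ltn_trans.
rewrite inE eq_sym; case: (eqVneq x k) => [xk _|xk /= kr].
  rewrite -xk ltnn add0n; apply/esym/eqP; rewrite -leqn0 leqNgt -has_count.
  by apply/hasPn => j /(allP xr) xj; rewrite -leqNgt ltnW.
by rewrite (IHr (path_sorted srt) kr) (allP xr _ kr).
Qed.

End Involutions.

(** * Coordinates of words in the field operators *)

Section Wick.
Variables (R : realType) (d : nat) (q : R).
Local Notation C := R[i].
Local Notation V := (qvec R d).

Definition compatible m (g : 'I_m -> 'I_d) (s : 'S_m) : bool := [forall j, g (s j) == g j].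

Lemma compatible_lift m (g : 'I_m.+1 -> 'I_d) (s : 'S_m) :
  compatible g (lift_perm ord0 ord0 s) = compatible (g \o lift ord0) s.
Proof.
apply/forallP/forallP => h i.
  by have := h (lift ord0 i); rewrite lift_perm_lift.
by case: (unliftP ord0 i) => [j|] ->; rewrite ?lift_perm_lift ?lift_perm_id //; exact: h.
Qed.

Lemma compatible_join m (g : 'I_m.+1 -> 'I_d) k (s : 'S_m) : s k = k ->
  compatible g (join0 k s) = (g (lift ord0 k) == g ord0) && compatible (g \o lift ord0) s.
Proof.
move=> sk; have sN j : j != k -> s j != k by move=> jk; rewrite -sk (inj_eq perm_inj).
apply/forallP/andP => [h|[/eqP gk /forallP h] i].
  split; first by have := h ord0; rewrite join0_0.
  apply/forallP => j; case: (eqVneq j k) => [->|jk]; first by rewrite sk.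
  by have := h (lift ord0 j); rewrite join0_lift // sN.
case: (unliftP ord0 i) => [j|] ->; last by rewrite join0_0 gk.
case: (eqVneq j k) => [->|jk]; first by rewrite join0_k // gk.
by rewrite join0_lift ?sN //; exact: h.
Qed.

Lemma insert_eqE (T : eqType) (a : T) (w v : seq T) p : (p <= size w)%N -> size v = (size w).+1 ->
  (take p w ++ a :: drop p w == v) = (nth a v p == a) && (w == take p v ++ drop p.+1 v).
Proof.
move=> pw sv; have pv : (p < size v)%N by rewrite sv ltnS.
have szw : size (take p w) = p by rewrite size_take; case: ltngtP pw => // ->.
have szv : size (take p v) = p by rewrite size_take pv.
rewrite -{1}(cat_take_drop p v) (drop_nth a pv) eqseq_cat ?szw ?szv // eqseq_cons.
rewrite -{3}(cat_take_drop p w) eqseq_cat ?szw ?szv // [a == _]eq_sym.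
by case: (nth a v p == a); rewrite /= ?andbF ?andbT.
Qed.

(** On a basis vector annihilation is seen as deletion again. Both sides vanish unless v is one
    letter longer than w. *)
Lemma annl_delta i (v w : seq 'I_d) :
  annl q i (fun u => (u == v)%:R) w = \sum_(p < size v)
    q%:C ^+ p * ((nth i v p == i) && (w == take p v ++ drop p.+1 v))%:R.
Proof.
rewrite /annl; have [sv|sv] := eqVneq (size v) (size w).+1.
  rewrite -sv; apply: eq_bigr => p _; rewrite insert_eqE //.
  by rewrite -ltnS -sv.
rewrite !big1 // => p _.
  case: andP => [[_ /eqP ww]|_]; last by rewrite mulr0.
  case/eqP: sv; rewrite ww size_cat size_drop size_take ltn_ord; by rewrite -addSn subnKC.
case: eqP => [vE|_]; last by rewrite mulr0.
case/eqP: sv; rewrite -vE size_cat /= size_drop addnS -[p : nat]/(nat_of_ord p).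
have pw : (p <= size w)%N by rewrite -ltnS.
by rewrite size_takel // subnKC.
Qed.

Lemma annl_sum (I : finType) (P : pred I) (c : I -> C) (f : I -> V) i w :
  annl q i (fun u => \sum_(s | P s) c s * f s u) w = \sum_(s | P s) c s * annl q i (f s) w.
Proof.
rewrite /annl; under eq_bigr do rewrite mulr_sumr.
rewrite exchange_big; apply: eq_bigr => s _; rewrite mulr_sumr.
by apply: eq_bigr => k _; rewrite mulrCA.
Qed.

Lemma big_index (T : eqType) (x0 : T) (r : seq T) (F : nat -> T -> C) : uniq r ->
  \sum_(p < size r) F p (nth x0 r p) = \sum_(k <- r) F (index k r) k.
Proof.
move=> ur; rewrite [RHS](big_nth x0) big_mkord; apply: eq_bigr => p _.
by rewrite index_uniq.
Qed.

(** Induction on the word. The creation part of the first letter adds 0 as a fixed point; the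
    annihilation part contracts 0 with a fixed point k of the same colour, at the cost of q to the
    rank of k among the fixed points. *)
Lemma Xword_wick m (g : 'I_m -> 'I_d) (v : seq 'I_d) :
  Xword q [seq g j | j <- enum 'I_m] v =
  \sum_(s : 'S_m | involution s && compatible g s)
    q%:C ^+ crossing_weight s * (v == [seq g j | j <- fixpoints s])%:R.
Proof.
elim: m g v => [|m IHm] g v.
  have e0 : enum 'I_0 = [::] by apply: size0nil; rewrite size_enum_ord.
  rewrite e0 (bigD1 1%g) /=; last by apply/andP; split; apply/forallP => -[].
  rewrite big1 => [|s /andP[_]]; last by case/eqP; apply/permP => -[].
  by rewrite /crossing_weight big_ord0 expr0 mul1r addr0 /fixpoints e0.
rewrite enum_ordSl /= -map_comp -/(Xword q _) /Xop -[LHS]/(_ v + _ v).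
set a := g ord0; set g' := g \o _.
have -> : Xword q [seq g' j | j <- enum 'I_m] = fun v =>
    \sum_(s : 'S_m | involution s && compatible g' s)
    q%:C ^+ crossing_weight s * (v == [seq g' j | j <- fixpoints s])%:R.
  by apply/funext => u; exact: IHm.
rewrite [RHS]big_mkcond big_perm_join; congr (_ + _).
  rewrite -big_mkcond /=; under [RHS]eq_bigl do rewrite involution_lift compatible_lift.
  under [RHS]eq_bigr do rewrite crossing_weight_lift fixpoints_lift /= -map_comp.
  case: v => [|b v] /=; first by rewrite big1 // => s _; rewrite mulr0.
  rewrite ebasisE mulr_sumr; apply: eq_bigr => s _.
  by rewrite eqseq_cons eq_sym mulrCA; case: (b == a); rewrite ?mul1r ?mul0r ?mulr0.
rewrite annl_sum big_mkcond; apply: eq_bigr => s _.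
case: (boolP (involution s)) => [si|/negbTE si] /=; last first.
  by rewrite big1 // => k _; rewrite involution_join si.
rewrite annl_delta size_map.
transitivity (\sum_(k <- fixpoints s) if compatible g (join0 k s) then
    q%:C ^+ crossing_weight (join0 k s) *
    (v == [seq g j | j <- fixpoints (join0 k s)])%:R else 0); last first.
  rewrite big_filter big_enum_cond big_mkcond; apply: eq_bigr => k _ /=.
  by rewrite involution_join si /=; case: ifP.
(* A first fixed point [k0] is needed as the default value in [big_index]. *)
case rE: (fixpoints s) => [|k0 r].
  by rewrite big_nil big_ord0 mulr0 if_same.
rewrite -rE; have ur : uniq (fixpoints s) by rewrite filter_uniq // enum_uniq.
have -> : \sum_(p < size (fixpoints s)) q%:C ^+ p *
    ((nth a [seq g' j | j <- fixpoints s] p == a) && (v == take p [seq g' j | j <- fixpoints s] ++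
    drop p.+1 [seq g' j | j <- fixpoints s]))%:R =
  \sum_(k <- fixpoints s) q%:C ^+ index k (fixpoints s) *
    ((g' k == a) && (v == [seq g' j | j <- rem k (fixpoints s)]))%:R.
  rewrite -(big_index k0 (fun p k => q%:C ^+ p * ((g' k == a) && (v == [seq g' j | j <- rem k (fixpoints s)]))%:R) ur).
  apply: eq_bigr => p _; rewrite (nth_map k0) // remE index_uniq // map_cat map_take map_drop //.
case: (boolP (compatible g' s)) => cs /=; last first.
  rewrite big_seq big1 // => k; rewrite mem_filter => /andP[/eqP sk _].
  by rewrite compatible_join // -/g' (negbTE cs) andbF.
rewrite mulr_sumr big_seq [RHS]big_seq.
apply: eq_bigr => k; rewrite mem_filter => /andP[/eqP sk _].
rewrite compatible_join // -/g' cs andbT crossing_weight_join // index_fixpoints //.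
rewrite fixpoints_join // -map_comp -/g' exprD -/a.
by case: (_ == a); rewrite /= ?mulr0 // mulrA.
Qed.

Lemma Xword_vacuum m (g : 'I_m -> 'I_d) :
  Xword q [seq g j | j <- enum 'I_m] [::] =
  \sum_(s : 'S_m | [&& involution s, [forall j, s j != j] & compatible g s])
    q%:C ^+ crossing_weight s.
Proof.
rewrite Xword_wick big_mkcond [RHS]big_mkcond /=; apply: eq_bigr => s _.
have -> : ([::] == [seq g j | j <- fixpoints s]) = [forall j, s j != j].
  rewrite eq_sym -size_eq0 size_map size_filter -leqn0 leqNgt -has_count.
  rewrite -all_predC; apply/allP/forallP => h j; last by move=> _; exact: h.
  by apply: h; rewrite mem_enum.
by case: (involution s); case: (compatible g s); case: [forall j, s j != j]; rewrite /= ?mulr1 ?mulr0.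
Qed.

End Wick.

(** * Pair partitions and meandric systems *)

Lemma set2_eq (T : finType) (x y u v : T) : x != y ->
  [set x; y]%SET = [set u; v]%SET -> (x = u /\ y = v) \/ (x = v /\ y = u).
Proof.
move=> xy e; have := set21 x y; have := set22 x y; rewrite e !inE.
move=> /orP[/eqP yE|/eqP yE] /orP[/eqP xE|/eqP xE]; [|by right|by left|];
  by case/eqP: xy; rewrite xE yE.
Qed.

Section Pairings.
Variable m : nat.
Implicit Types (s : 'S_m) (P : {set {set 'I_m}}).

Definition pairing_perm s : bool := involution s && [forall j, s j != j].

Definition pairing s : {set {set 'I_m}} := [set [set i; s i] | i : 'I_m]%SET.

Lemma pairing_permP s : reflect ((forall i, s (s i) = i) /\ (forall i, s i != i)) (pairing_perm s).
Proof.
apply: (iffP andP) => [[/forallP h1 /forallP h2]|[h1 h2]].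
  by split => i; [exact/eqP|exact: h2].
by split; apply/forallP => i; [exact/eqP|exact: h2].
Qed.

Lemma mem_pairing s i : [set i; s i]%SET \in pairing s.
Proof. exact: imset_f. Qed.

Lemma pairing_mem s x y : pairing_perm s -> x != y -> [set x; y]%SET \in pairing s -> s x = y.
Proof.
move=> /pairing_permP[ss _] xy /imsetP[k _ /(set2_eq xy)[[-> ->] //|[-> ->]]].
exact: ss.
Qed.

Lemma pairing_partition s : pairing_perm s -> pairing s \in pair_partitions m.
Proof.
move=> ps; have /pairing_permP[ss sf] := ps; rewrite inE; apply/andP; split; last first.
  by apply/forall_inP => B /imsetP[i _ ->]; rewrite cards2 (eq_sym i) sf.
apply/and3P; split.
- apply/eqP/setP => i; rewrite inE; apply/bigcupP; exists [set i; s i]%SET; first exact: mem_pairing.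
  exact: set21.
- apply/finset.trivIsetP => _ _ /imsetP[i _ ->] /imsetP[j _ ->]; apply: contraR.
  move=> /pred0Pn[k] /=; rewrite !inE => /andP[ki kj].
  have bk l : (k == l) || (k == s l) -> [set l; s l]%SET = [set k; s k]%SET.
    by case/orP => /eqP ->; rewrite ?ss // finset.setUC.
  by rewrite (bk i ki) (bk j kj).
- by apply/imsetP => -[i _ e]; have := set21 i (s i); rewrite -e inE.
Qed.

Lemma pairing_inj : {in pairing_perm &, injective pairing}.
Proof.
move=> s s' ps ps' e; apply/permP => i.
have /pairing_permP[_ sf] := ps.
by apply/esym/pairing_mem; rewrite // -?e ?mem_pairing // eq_sym.
Qed.

Lemma pairing_surj P : P \in pair_partitions m -> exists2 s, pairing_perm s & P = pairing s.
Proof.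
rewrite inE => /andP[/and3P[/eqP cP tP nP] /forall_inP P2].
have block_pair B x : B \in P -> x \in B -> exists2 y, y != x & B = [set x; y]%SET.
  move=> BP; have /cards2P[u [v [uv ->]]] := P2 _ BP.
  rewrite !inE => /orP[/eqP ->|/eqP ->]; first by exists v => //; rewrite eq_sym.
  by exists u => //; rewrite finset.setUC.
have ex i : [exists j, (j != i) && ([set i; j]%SET \in P)].
  have iP : i \in finset.cover P by rewrite cP inE.
  have bP := finset.pblock_mem iP.
  have [y yi e] : exists2 y, y != i & finset.pblock P i = [set i; y]%SET.
    by apply: block_pair => //; rewrite finset.mem_pblock.
  by apply/existsP; exists y; rewrite yi -e.
pose f i := xchoose (existsP (ex i)).
have fP i : f i != i /\ [set i; f i]%SET \in P by exact/andP/(xchooseP (existsP (ex i))).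
have fU i j : j != i -> [set i; j]%SET \in P -> f i = j.
  move=> ji ijP; have [fi iP] := fP i.
  have e : [set i; j]%SET = [set i; f i]%SET.
    by rewrite -(finset.def_pblock tP ijP (set21 i j)) -(finset.def_pblock tP iP (set21 i (f i))).
  have /orP[/eqP ji'|/eqP //] : (j == i) || (j == f i) by have := set22 i j; rewrite e !inE.
  by rewrite ji' eqxx in ji.
have ff i : f (f i) = i.
  by have [fi iP] := fP i; apply: fU; [rewrite eq_sym|rewrite finset.setUC].
have finj : injective f by move=> i j ij; rewrite -(ff i) ij ff.
exists (perm finj).
  by apply/pairing_permP; split => i; rewrite !permE ?ff //; case: (fP i).
apply/setP => B; apply/idP/imsetP => [BP|[i _ ->]]; last by rewrite permE; case: (fP i).
have /finset.set0Pn[x xB] : B != finset.set0 by apply: contraNneq nP => <-.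
have [y yx e] := block_pair B x BP xB; exists x => //.
by rewrite permE (fU x y) // -e.
Qed.

Lemma pair_partitionsE : pair_partitions m = [set pairing s | s in pairing_perm]%SET.
Proof.
apply/setP => P; apply/idP/imsetP => [/pairing_surj[s ps ->]|[s ps ->]]; first by exists s.
exact: pairing_partition.
Qed.

Definition crossing_pairs s : {set 'I_m * 'I_m} :=
  [set p : 'I_m * 'I_m | [&& p.1 < p.2, p.2 < s p.1 & s p.1 < s p.2]%N]%SET.

Lemma crossing_weightE s : pairing_perm s -> crossing_weight s = #|crossing_pairs s|.
Proof.
move=> /pairing_permP[_ sf]; rewrite -sum1_card big_mkcond /=.
rewrite /crossing_weight pair_big /=; apply: eq_bigr => -[a b] _.
by rewrite inE /= (negbTE (sf b)) orbF; case: [&& _, _ & _].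
Qed.

(** An unordered pair of crossing blocks is determined by its two smallest points, the opening
    points a < b of the blocks. *)
Lemma crossings_pairing s : pairing_perm s -> crossings (pairing s) = crossing_weight s.
Proof.
move=> ps; have /pairing_permP[ss sf] := ps; rewrite crossing_weightE //.
pose f (p : 'I_m * 'I_m) : {set {set 'I_m}} := [set [set p.1; s p.1]; [set p.2; s p.2]]%SET.
have block_inj (a b : 'I_m) : (a < s a)%N -> (b < s b)%N -> [set a; s a]%SET = [set b; s b]%SET -> a = b.
  move=> asa bsb; have asa' : a != s a by rewrite eq_sym.
  by case/(set2_eq asa') => -[// ab sab]; move: asa bsb; rewrite sab ab ltnNge => /negbTE asa /ltnW; rewrite asa.
rewrite -(card_in_imset (f := f)).
  rewrite /crossings; apply: eq_card => X; apply/imset2P/imsetP; last first.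
    move=> [[a b]]; rewrite inE /= => /and3P[ab bsa sab] ->.
    apply: (Imset2spec (x1 := [set a; s a]%SET) (x2 := [set b; s b]%SET)) => //.
      exact: mem_pairing.
    rewrite inE mem_pairing /=; apply/existsP; exists a; apply/existsP; exists b.
    apply/existsP; exists (s a); apply/existsP; exists (s b).
    by rewrite ab bsa sab !eqxx.
  move=> [V W VP]; rewrite inE => /andP[WP /existsP[a /existsP[b /existsP[c /existsP[e]]]]].
  case/and4P => ab bc ce VW ->.
  have ac : a != c by rewrite -val_eqE neq_ltn (ltn_trans ab bc).
  have be : b != e by rewrite -val_eqE neq_ltn (ltn_trans bc ce).
  suff [sa sb XE] : [/\ s a = c, s b = e & [set V; W]%SET = [set [set a; c]; [set b; e]]%SET].
    by exists (a, b); rewrite ?inE /= ?sa ?sb ?ab ?bc ?ce //= XE /f /= sa sb.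
  case/orP: VW => /andP[/eqP VE /eqP WE]; rewrite VE WE in VP WP *.
    by split; [exact: pairing_mem|exact: pairing_mem|].
  by split; [exact: pairing_mem|exact: pairing_mem|rewrite finset.setUC].
move=> [a b] [a' b']; rewrite !inE /= => /and3P[ab bsa sab] /and3P[ab' bsa' sab'].
have [oa ob oa' ob'] : [/\ (a < s a)%N, (b < s b)%N, (a' < s a')%N & (b' < s b')%N].
  by split; lia.
have ne : [set a; s a]%SET != [set b; s b]%SET.
  by apply/eqP => /(block_inj _ _ oa ob) E; rewrite E ltnn in ab.
case/(set2_eq ne) => -[].
  by move=> /(block_inj _ _ oa oa') -> /(block_inj _ _ ob ob') ->.
move=> /(block_inj _ _ oa ob') E1 /(block_inj _ _ ob oa') E2.
by move: ab'; rewrite -E1 -E2 ltnNge ltnW.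
Qed.

End Pairings.

(** * Systems with a rainbow below, and their joint colourings *)

Section RainbowSystems.
Variable n : nat.
Local Notation m := (2 * n)%N.
Implicit Types (s : 'S_m).

Definition rainbow_perm : 'S_m := perm (@rev_ord_inj m).

Lemma rainbow_perm_pairing : pairing_perm rainbow_perm.
Proof.
apply/pairing_permP; split => i; rewrite !permE ?rev_ordK // -val_eqE /=.
by apply/eqP => h; have := ltn_ord i; lia.
Qed.

Lemma rainbowE : rainbow n = pairing rainbow_perm.
Proof. by apply: eq_imset => i; rewrite permE. Qed.

Lemma crossings_rainbow : crossings (rainbow n) = 0%N.
Proof.
rewrite rainbowE crossings_pairing ?rainbow_perm_pairing // crossing_weightE ?rainbow_perm_pairing //.
apply/eqP; rewrite cards_eq0; apply/eqP/setP => -[a b]; rewrite !inE /= !permE /=.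
by apply/and3P => -[ab _ ba]; have := ltn_ord a; have := ltn_ord b; lia.
Qed.

(** Crossings inject into the ordered pairs of distinct opening points, whence the range of l in
    [Qtilde]. The set [D] below is the diagonal to be removed. *)
Lemma crossings_bound s : pairing_perm s -> (crossings (pairing s) <= n ^ 2 - n)%N.
Proof.
move=> ps; have /pairing_permP[ss sf] := ps.
rewrite crossings_pairing // crossing_weightE //.
pose O : {set 'I_m} := [set a : 'I_m | (a < s a)%N]%SET.
(* The involution exchanges opening and closing points, so there are equally many of each. *)
have cO : #|O| = n.
  have : (#|O| + #|~: O|)%N = m by rewrite cardsC card_ord.
  have -> : (~: O)%SET = [set s i | i in O]%SET.
    apply/setP => i; rewrite !inE; apply/idP/imsetP => [h|[j + ->]].
      exists (s i); rewrite ?ss // inE ss ltn_neqAle leqNgt h andbT.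
      by rewrite val_eqE sf.
    by rewrite inE ss -leqNgt => /ltnW.
  by rewrite card_imset; [lia|exact: perm_inj].
pose D : {set 'I_m * 'I_m} := [set (a, a) | a in O]%SET.
have cD : #|D| = n by rewrite card_imset ?cO // => a b [].
have dis : (crossing_pairs s :&: D)%SET = finset.set0.
  apply/setP => -[a b]; rewrite !inE /=; apply/andP => -[h /imsetP[c _ [ac bc]]].
  by move: h; rewrite ac bc ltnn.
have sub : (crossing_pairs s :|: D)%SET \subset (finset.setX O O)%SET.
  apply/fintype.subsetP => -[a b]; rewrite !inE => /orP[/and3P[/= ab bsa sab]|/imsetP[c cO' [ac bc]]].
    by apply/andP; split; lia.
  by rewrite ac bc; rewrite inE in cO'; rewrite cO'.
have := subset_leq_card sub; rewrite cardsX cO finset.cardsU.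
by rewrite dis cards0 cD -mulnn; lia.
Qed.

Variable d : nat.

Definition joint_colorings s : {set {ffun 'I_m -> 'I_d}} :=
  [set g : {ffun 'I_m -> 'I_d} | [forall i, g (s i) == g i] && [forall i, g (rev_ord i) == g i]]%SET.

Lemma pairing_joinP s : pairing_perm s ->
  is_join (pairing s) (rainbow n) (partition_join (pairing s) (rainbow n)).
Proof.
move=> ps; have := pairing_partition ps; have := pairing_partition rainbow_perm_pairing.
rewrite !inE rainbowE => /andP[pr _] /andP[pp _]; exact: partition_joinP.
Qed.

Lemma join_same_block s i : pairing_perm s ->
  let J := partition_join (pairing s) (rainbow n) in
  finset.pblock J (s i) = finset.pblock J i /\ finset.pblock J (rev_ord i) = finset.pblock J i.
Proof.
move=> ps J; have /and4P[/and3P[_ tJ _] rP rR _] := pairing_joinP ps.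
have same u v : (exists2 W, W \in J & [set u; v]%SET \subset W) -> finset.pblock J v = finset.pblock J u.
  move=> [W WJ /fintype.subsetP sub].
  by rewrite !(finset.def_pblock tJ WJ) //; apply: sub; rewrite ?set21 ?set22.
split; apply: same; apply/exists_inP.
  by move/forall_inP: rP => /(_ _ (mem_pairing s i)).
have := mem_pairing rainbow_perm i; rewrite permE -rainbowE => h.
by move/forall_inP: rR => /(_ _ h).
Qed.

(** The level sets of a joint colouring form a partition [K] coarser than both pairings, hence
    coarser than their join. Joint colourings are thus the functions on the blocks of the join. *)
Lemma card_joint_colorings s (x0 : 'I_d) : pairing_perm s ->
  #|joint_colorings s| = (d ^ #|partition_join (pairing s) (rainbow n)|)%N.
Proof.
move=> ps; have := pairing_joinP ps; have := join_same_block _ ps.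
set J := partition_join _ _ => /= same /and4P[pJ rP rR /forallP minJ].
have /and3P[/eqP cJ tJ nJ] := pJ.
have inJ i : i \in finset.cover J by rewrite cJ inE.
(* A function on the blocks is encoded as a function on all sets with the value [x0] off [J]. *)
have := card_pffun_on x0 (mem J) (mem 'I_d); rewrite card_ord => <-.
pose f (h : {ffun {set 'I_m} -> 'I_d}) : {ffun 'I_m -> 'I_d} := [ffun i => h (finset.pblock J i)].
rewrite -(card_in_imset (f := f)) => [|h h' /pffun_onP[sh _] /pffun_onP[sh' _] e]; last first.
  apply/ffunP => B; case: (boolP (B \in J)) => [BJ|nBJ]; last first.
    have out (k : {ffun {set 'I_m} -> 'I_d}) : x0.-support k \subset mem J -> k B = x0.
      by move=> /fintype.subsetP/(_ B) sk; apply/eqP; apply: contraNT nBJ => /sk.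
    by rewrite !out.
  have /finset.set0Pn[x xB] : B != finset.set0 by apply: contraNneq nJ => <-.
  by have /ffunP/(_ x) := e; rewrite !ffunE (finset.def_pblock tJ BJ xB).
apply: eq_card => g; apply/idP/imsetP => [|[h _ ->]]; last first.
  by rewrite inE; apply/andP; split; apply/forallP => i; rewrite !ffunE; have [e1 e2] := same i; rewrite ?e1 ?e2.
rewrite inE => /andP[/forallP gs /forallP gr].
pose K := preim_partition g [set: 'I_m]%SET.
have gK i : [set j | g i == g j]%SET \in K.
  by apply/imsetP; exists i => //; apply/setP => j; rewrite !inE.
have refK u v : g v == g u -> [exists W in K, [set u; v]%SET \subset W].
  move=> vu; apply/exists_inP; exists [set j | g u == g j]%SET => //.
  by apply/fintype.subsetP => j; rewrite !inE => /orP[/eqP ->|/eqP ->] //; rewrite eq_sym.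
have JK : refines J K.
  apply: (implyP (minJ K)); apply/and3P; split; first exact: preim_partitionP.
    by apply/forall_inP => V /imsetP[i _ ->]; apply: refK; exact: gs.
  by apply/forall_inP => V /imsetP[i _ ->]; apply: refK; exact: gr.
have gJ i j : j \in finset.pblock J i -> g j = g i.
  move=> ji; have /forall_inP/(_ _ (finset.pblock_mem (inJ i)))/exists_inP[W WK /fintype.subsetP sub] := JK.
  have iW : i \in W by apply: sub; rewrite finset.mem_pblock.
  have jW : j \in W by apply: sub.
  case/imsetP: WK iW jW => k _ ->; rewrite !inE /= => /eqP <- /eqP <- //.
pose h : {ffun {set 'I_m} -> 'I_d} :=
  [ffun B => if B \in J then if [pick j in B] is Some j then g j else x0 else x0].
exists h.
  apply/pffun_onP; split => //; apply/fintype.subsetP => B; rewrite !inE ffunE.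
  by case: ifP => //; rewrite eqxx.
apply/ffunP => i; rewrite !ffunE finset.pblock_mem //.
case: pickP => [j /gJ -> //|/(_ i)].
by rewrite finset.mem_pblock inJ.
Qed.

(** Every block of the join contains a point together with its partner, so it uses at least two of
    the 2n points. *)
Lemma join_card_bound s : (0 < n)%N -> pairing_perm s ->
  (0 < #|partition_join (pairing s) (rainbow n)| < n.+1)%N.
Proof.
move=> n0 ps; have := pairing_joinP ps; have := join_same_block _ ps.
set J := partition_join _ _ => /= same /and4P[pJ _ _ _].
have /and3P[/eqP cJ tJ nJ] := pJ.
have inJ i : i \in finset.cover J by rewrite cJ inE.
have i0 : 'I_m by exists 0%N; rewrite muln_gt0.
apply/andP; split; first by rewrite card_gt0; apply/finset.set0Pn; exists (finset.pblock J i0); exact: finset.pblock_mem.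
have := card_partition pJ; rewrite cardsT card_ord => mE.
have : (\sum_(B in J) 2 <= \sum_(B in J) #|B|)%N.
  apply: leq_sum => B BJ.
  have /finset.set0Pn[x xB] : B != finset.set0 by apply: contraNneq nJ => <-.
  have /pairing_permP[_ /(_ x) sx] := ps.
  have c2 : #|[set x; s x]%SET| = 2%N by rewrite cards2 (eq_sym x) sx.
  rewrite -[X in (X <= _)%N]c2.
  apply: subset_leq_card; apply/fintype.subsetP => y; rewrite !inE => /orP[/eqP -> //|/eqP ->].
  by rewrite -(finset.def_pblock tJ BJ xB); have [<- _] := same x; rewrite finset.mem_pblock.
by rewrite -mE sum_nat_const mulnC leq_mul2l ltnS.
Qed.

End RainbowSystems.

(** The ranges of k and l catch each pairing exactly once, by [join_card_bound] and
    [crossings_bound], and the rainbow adds no crossing of its own. *)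
Lemma Qtilde_pairings (A : comPzRingType) n (t u : A) : (0 < n)%N ->
  Qtilde n t u = \sum_(s : 'S_(2 * n) | pairing_perm s)
    t ^+ #|partition_join (pairing s) (rainbow n)| * u ^+ crossing_weight s.
Proof.
move=> n0; pose cv P := #|partition_join P (rainbow n)|.
have cntE k l : rainbow_count n k l =
    #|[set P in pair_partitions (2 * n) | (cv P == k) && (crossings P == l)]%SET|.
  rewrite /rainbow_count -[RHS](card_imset _ (f := fun P => (P, rainbow n))) => [|P P' [//]].
  apply: eq_card => -[P Q]; rewrite !inE /=; apply/idP/imsetP.
    move=> /andP[/andP[PP _] /and3P[/eqP -> ck xl]]; exists P => //.
    by move: ck xl; rewrite /system_crossings /= crossings_rainbow addn0 !inE in PP * => -> ->; rewrite PP.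
  move=> [P']; rewrite !inE => /andP[PP /andP[ck xl]] [-> ->].
  rewrite PP eqxx /system_crossings /= crossings_rainbow addn0 xl andbT.
  have := pairing_partition (rainbow_perm_pairing n); rewrite -rainbowE inE => ->.
  by rewrite ck.
transitivity (\sum_(P in pair_partitions (2 * n)) t ^+ cv P * u ^+ crossings P); last first.
  rewrite pair_partitionsE big_imset /=; last exact: pairing_inj.
  by apply: eq_bigr => s ps; rewrite crossings_pairing.
rewrite /Qtilde.
transitivity (\sum_(1 <= k < n.+1) \sum_(0 <= l < (n ^ 2 - n).+1)
   \sum_(P in pair_partitions (2 * n)) if (cv P == k) && (crossings P == l) then t ^+ k * u ^+ l else 0).
  apply: eq_bigr => k _; apply: eq_bigr => l _; rewrite cntE -sum1_card natr_sum !mulr_suml.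
  rewrite -big_mkcondr /=; apply: eq_big => [P|P _]; first by rewrite inE.
  by rewrite mul1r.
under eq_bigr do rewrite exchange_big /=.
rewrite exchange_big /=; apply: eq_bigr => P; rewrite pair_partitionsE => /imsetP[s ps PE].
have /andP[c0 c1] := join_card_bound n0 ps; have x1 := crossings_bound ps.
rewrite (bigD1_seq (cv P)) ?iota_uniq ?mem_index_iota //=; last by rewrite /cv PE c0.
rewrite [X in _ + X]big1 ?addr0 => [|k /negbTE kc]; last first.
  by rewrite big1 // => l _; rewrite eq_sym kc.
rewrite (bigD1_seq (crossings P)) ?iota_uniq ?mem_index_iota //=; last by rewrite PE ltnS.
rewrite [X in _ + X]big1 ?addr0 => [|l /negbTE kl]; first by rewrite !eqxx.
by rewrite [crossings P == l]eq_sym kl andbF.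
Qed.

(** * Vacuum moments *)

Section PalindromeColorings.
Variables (n d : nat) (x0 : 'I_d).
Local Notation m := (2 * n)%N.
Implicit Types (t : n.-tuple 'I_d).

Definition palindrome t : {ffun 'I_m -> 'I_d} := [ffun j : 'I_m => nth x0 (t ++ rev t) j].

Lemma palindrome_word t : t ++ rev t = [seq palindrome t j | j <- enum 'I_m].
Proof.
have sz : size (t ++ rev t) = m by rewrite size_cat size_rev size_tuple; lia.
rewrite (eq_map (g := fun j : 'I_m => nth x0 (t ++ rev t) j)) => [|j]; last by rewrite ffunE.
by rewrite (map_comp (nth x0 (t ++ rev t)) val) val_enum_ord -sz -[LHS](mkseq_nth x0).
Qed.

Lemma palindrome_inj : injective palindrome.
Proof.
move=> t t' e; apply: eq_from_tnth => i; rewrite !(tnth_nth x0).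
have im : (i < m)%N by have := ltn_ord i; lia.
have := congr1 (fun g : {ffun 'I_m -> 'I_d} => g (Ordinal im)) e.
by rewrite !ffunE /= !nth_cat !size_tuple ltn_ord.
Qed.

(** A colouring is constant on the blocks of the rainbow exactly when its word is a palindrome, and
    it is then determined by its first half t. *)
Lemma card_compatible_palindrome (s : 'S_m) :
  #|[set t | compatible (palindrome t) s]%SET| = #|joint_colorings d s|.
Proof.
rewrite -(card_imset _ palindrome_inj); apply: eq_card => g; rewrite inE.
apply/imsetP/andP => [[t + ->]|[gs gr]].
  rewrite inE => h; split; first exact: h.
  apply/forallP => j; rewrite !ffunE /=.
  have sz : size (t ++ rev t) = m by rewrite size_cat size_rev size_tuple; lia.
  have revE : rev (t ++ rev t) = t ++ rev t by rewrite rev_cat revK.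
  by rewrite -{2}revE nth_rev sz.
have wm (i : 'I_n) : (i < m)%N by have := ltn_ord i; lia.
pose t : n.-tuple 'I_d := [tuple g (Ordinal (wm i)) | i < n].
have tE i : (i < n)%N -> forall j : 'I_m, j = i :> nat -> nth x0 t i = g j.
  move=> iN j ji; have -> : i = val (Ordinal iN) by [].
  rewrite -tnth_nth tnth_mktuple.
  by congr (g _); apply: val_inj.
have gt : g = palindrome t.
  apply/ffunP => j; rewrite ffunE nth_cat size_tuple; case: ltnP => jn.
    by rewrite (tE _ jn j).
  rewrite nth_rev ?size_tuple; last by have := ltn_ord j; lia.
  have jm := ltn_ord j.
  rewrite (tE _ _ (rev_ord j)); [|lia|rewrite /=; lia].
  by apply/esym/eqP/(forallP gr).
exists t => //; rewrite inE -gt; exact: gs.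
Qed.

End PalindromeColorings.

Lemma vacuum_moment_Qtilde (R : realType) (d : nat) (q : R) n :
  -1 < q < 1 -> (0 < d)%N -> (0 < n)%N ->
  vacuum_state q (fun x => iter n (Top d q) x) = (Qtilde n d%:R q)%:C.
Proof.
move=> hq d0 n0; have x0 : 'I_d by exists 0%N.
rewrite vacuum_moment // Qtilde_pairings // rmorph_sum /=.
under eq_bigr => t _ do rewrite (palindrome_word x0) Xword_vacuum.
rewrite (exchange_big_dep (@pairing_perm _)) /=; last first.
  by move=> t s _ /and3P[h1 h2 _]; rewrite /pairing_perm h1.
apply: eq_bigr => s ps; have /andP[h1 h2] := ps.
rewrite (eq_bigl (mem [set t | compatible (palindrome x0 t) s]%SET)) => [|t]; last first.
  by rewrite /= inE h1 h2.
rewrite sumr_const card_compatible_palindrome card_joint_colorings //.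
by rewrite rmorphM !rmorphXn rmorph_nat -[LHS]mulr_natl natrX.
Qed.

(** * Gauss quadrature for Hankel forms *)

Section Quadrature.
Variable C : numClosedFieldType.
Local Open Scope sesquilinear_scope.

Let entryD m n (X Y : 'M[C]_(m, n)) i j : (X + Y) i j = X i j + Y i j.
Proof. by rewrite mxE. Qed.

Let entryN m n (X : 'M[C]_(m, n)) i j : (- X) i j = - X i j.
Proof. by rewrite mxE. Qed.

Let entryZ m n a (X : 'M[C]_(m, n)) i j : (a *: X) i j = a * X i j.
Proof. by rewrite mxE. Qed.

Let entry0 m n i j : (0 : 'M[C]_(m, n)) i j = 0.
Proof. by rewrite mxE. Qed.

Lemma dotmx_self n (p : 'rV[C]_n) : (p *m p ^t*) 0 0 = \sum_j p 0 j * (p 0 j)^*.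
Proof. by rewrite mxE; apply: eq_bigr => j _; rewrite !mxE. Qed.

Lemma dotmx_self_ge0 n (p : 'rV[C]_n) : 0 <= (p *m p ^t*) 0 0.
Proof. by rewrite dotmx_self; apply: sumr_ge0 => j _; exact: mul_conjC_ge0. Qed.

Lemma dotmx_self_eq0 n (p : 'rV[C]_n) : (p *m p ^t*) 0 0 = 0 -> p = 0.
Proof.
rewrite dotmx_self => /eqP; rewrite psumr_eq0 => [/allP h|j _]; last exact: mul_conjC_ge0.
apply/rowP => j; rewrite mxE; apply/eqP; rewrite -mul_conjC_eq0.
by apply: h; rewrite mem_index_enum.
Qed.

Lemma trC_mul m n p (A : 'M[C]_(m, n)) (B : 'M[C]_(n, p)) : (A *m B) ^t* = B ^t* *m A ^t*.
Proof. by rewrite trmx_mul map_mxM. Qed.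

(** With p = r Q, the form at r + t p equals 2 t a + t^2 c, which is negative for small negative t
    unless p = 0. The choice t = - a / (c + 1) remains valid for c = 0. *)
Lemma psd_isotropic n (Q : 'M[C]_n) (r : 'rV[C]_n) : Q ^t* = Q ->
  (forall x : 'rV[C]_n, 0 <= (x *m Q *m x ^t*) 0 0) ->
  (r *m Q *m r ^t*) 0 0 = 0 -> r *m Q = 0.
Proof.
move=> QQ psd r0; set p := r *m Q.
set a := (p *m p ^t*) 0 0; set c := (p *m Q *m p ^t*) 0 0.
have a0 : 0 <= a by exact: dotmx_self_ge0.
have c0 : 0 <= c by exact: psd.
apply: dotmx_self_eq0; rewrite -/a.
have s0 : 0 < c + 1 by rewrite ltr_wpDl.
pose t := - (a / (c + 1)).
have tr : t^* = t.
  by apply: conj_Creal; rewrite rpredN rpred_div // ger0_real // ltW.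
have := psd (r + t *: p).
have -> : (r + t *: p) ^t* = r ^t* + t *: p ^t*.
  by rewrite linearD linearZ /= map_mxD map_mxZ; congr (_ + _ *: _); exact: tr.
rewrite !mulmxDl !mulmxDr -!scalemxAl -!scalemxAr !(entryD, entryZ).
have -> : (p *m Q *m r ^t*) 0 0 = a.
  by rewrite -mulmxA -[Q in LHS]QQ -trC_mul.
rewrite -/p r0 -/a -/c add0r.
have -> : t * a + (t * a + t * (t * c)) = - (a ^+ 2 * (c + 2) / (c + 1) ^+ 2).
  by rewrite /t; field; rewrite gt_eqF.
rewrite oppr_ge0 pmulr_lle0 ?invr_gt0 ?exprn_gt0 // pmulr_lle0 ?ltr_wpDl // => a2.
by apply/eqP; rewrite -sqrf_eq0 eq_le a2 exprn_ge0.
Qed.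

Lemma hermitian_diagonalization n (A : 'M[C]_n) : A ^t* = A ->
  exists (U : 'M[C]_n) (D : 'rV[C]_n), [/\ U *m U ^t* = 1%:M, U ^t* *m U = 1%:M,
    A = U ^t* *m diag_mx D *m U & forall j, D 0 j \is Num.real].
Proof.
move=> AA; have Ah : A \is hermsymmx by apply/is_hermitianmxP; rewrite expr0 scale1r AA.
exists (spectralmx A), (spectral_diag A); have Uu := spectral_unitarymx A.
split.
- exact/unitarymxP.
- by rewrite -invmx_unitary // mulVmx // spectral_unit.
- by rewrite -invmx_unitary //; exact/orthomx_spectralP/hermitian_normalmx.
- by move=> j; have /mxOverP/(_ 0 j) := hermitian_spectral_diag_real Ah.
Qed.

Lemma row_diag_mul n p (D : 'rV[C]_n) (X : 'M[C]_(n, p)) j :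
  row j (diag_mx D *m X) = D 0 j *: row j X.
Proof. by rewrite mul_diag_mx; apply/rowP => k; rewrite !mxE. Qed.

Lemma diag_form n (D : 'rV[C]_n) (x : 'rV[C]_n) :
  (x *m diag_mx D *m x ^t*) 0 0 = \sum_j x 0 j * (x 0 j)^* * D 0 j.
Proof.
by rewrite mxE; apply: eq_bigr => j _; rewrite mul_mx_diag !mxE mulrAC.
Qed.

(* With [A = G G*] the Gram matrix of the rows of [G], the compressed shift
   [S = G^+ B G^+*] sends row [i] of [G] to row [i + 1]; its spectral measure at
   row [0] is the quadrature. *)
Lemma hankel_quadrature N (h : nat -> C) (M : C) : 0 < M ->
  (forall k, (h k)^* = h k) ->
  let A := \matrix_(i < N.+1, j < N.+1) h (i + j)%N in
  let B := \matrix_(i < N.+1, j < N.+1) h (i + j).+1 in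
  (forall x : 'rV[C]_N.+1, 0 <= (x *m (M *: A + B) *m x ^t*) 0 0) ->
  (forall x : 'rV[C]_N.+1, 0 <= (x *m (M *: A - B) *m x ^t*) 0 0) ->
  exists (w l : 'I_N.+1 -> C), [/\ forall j, 0 <= w j, forall j, - M <= l j <= M &
    forall k, (k <= N)%N -> h k = \sum_j w j * l j ^+ k].
Proof.
move=> M0 hr A B psdp psdm.
have Mr : M^* = M by apply: conj_Creal; rewrite ger0_real // ltW.
have AA : A ^t* = A by apply/matrixP => i j; rewrite !mxE hr addnC.
have BB : B ^t* = B by apply/matrixP => i j; rewrite !mxE hr addnC.
have splitp (x : 'rV[C]_N.+1) : (x *m (M *: A + B) *m x ^t*) 0 0 = M * (x *m A *m x ^t*) 0 0 + (x *m B *m x ^t*) 0 0.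
  by rewrite mulmxDr mulmxDl -scalemxAr -scalemxAl entryD entryZ.
have splitm (x : 'rV[C]_N.+1) : (x *m (M *: A - B) *m x ^t*) 0 0 = M * (x *m A *m x ^t*) 0 0 - (x *m B *m x ^t*) 0 0.
  by rewrite mulmxBr mulmxBl -scalemxAr -scalemxAl entryD entryN entryZ.
have psdA (x : 'rV[C]_N.+1) : 0 <= (x *m A *m x ^t*) 0 0.
  have := addr_ge0 (psdp x) (psdm x); rewrite splitp splitm addrACA subrr addr0 -mulrDr.
  by rewrite pmulr_rge0 // -mulr2n pmulrn_lge0.
have [U [D [UU UU' AE Dr]]] := hermitian_diagonalization AA.
have UA : U *m A = diag_mx D *m U by rewrite AE !mulmxA UU mul1mx.
have rowUA j : row j U *m A = D 0 j *: row j U.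
  by rewrite -row_mul UA row_diag_mul.
have D0 j : 0 <= D 0 j.
  have := psdA (row j U); rewrite rowUA -scalemxAl entryZ.
  have -> : (row j U *m (row j U) ^t*) 0 0 = 1.
    transitivity ((U *m U ^t*) j j); last by rewrite UU mxE eqxx.
    by rewrite !mxE; apply: eq_bigr => k _; rewrite !mxE.
  by rewrite mulr1.
(* The kernel of A lies in the kernel of B: there the two forms reduce to B and - B, so the vector
   is isotropic for M A + B. *)
have rowUB j : D 0 j = 0 -> row j U *m B = 0.
  move=> Dj; have rA : row j U *m A = 0 by rewrite rowUA Dj scale0r.
  have := psdp (row j U); have := psdm (row j U).
  rewrite splitp splitm rA mul0mx entry0 mulr0 !add0r oppr_ge0 => b1 b2.
  have r0 : (row j U *m B *m (row j U) ^t*) 0 0 = 0 by apply/eqP; rewrite eq_le b1 b2.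
  have Q1 : (M *: A + B) ^t* = M *: A + B.
    by rewrite linearD linearZ /= map_mxD map_mxZ AA BB; congr (_ *: _ + _); exact: Mr.
  have := psd_isotropic Q1 psdp (r := row j U).
  rewrite splitp rA mul0mx entry0 mulr0 add0r => /(_ r0).
  by rewrite mulmxDr -scalemxAr rA scaler0 add0r.
pose sD : 'rV[C]_N.+1 := \row_j sqrtC (D 0 j).
(* Since 0^-1 = 0, this is the pseudo-inverse of [sD], and [e] is the projection onto the nonzero
   eigenvalues. *)
pose sDi : 'rV[C]_N.+1 := \row_j (sqrtC (D 0 j))^-1.
pose e : 'rV[C]_N.+1 := \row_j (D 0 j != 0)%:R.
have real_diag (v : 'rV[C]_N.+1) : (forall j, (v 0 j)^* = v 0 j) -> (diag_mx v) ^t* = diag_mx v.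
  move=> vr; rewrite tr_diag_mx map_diag_mx; congr diag_mx.
  by apply/rowP => j; rewrite mxE; exact: vr.
have sDr j : (sqrtC (D 0 j))^* = sqrtC (D 0 j).
  by apply: conj_Creal; rewrite ger0_real // sqrtC_ge0.
have sDiR : (diag_mx sDi) ^t* = diag_mx sDi.
  by apply: real_diag => j; rewrite mxE fmorphV; congr (_^-1); exact: sDr.
have sDR : (diag_mx sD) ^t* = diag_mx sD by apply: real_diag => j; rewrite mxE sDr.
have eR : (diag_mx e) ^t* = diag_mx e by apply: real_diag => j; rewrite mxE rmorph_nat.
have diagM (v v' v'' : 'rV[C]_N.+1) : (forall j, v 0 j * v' 0 j = v'' 0 j) ->
    diag_mx v *m diag_mx v' = diag_mx v''.
  by move=> vv; rewrite mulmx_diag; congr diag_mx; apply/rowP => j; rewrite mxE vv.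
have DD : diag_mx sD *m diag_mx sD = diag_mx D.
  by apply: diagM => j; rewrite !mxE -expr2 sqrtCK.
have De : diag_mx sDi *m diag_mx sD = diag_mx e.
  apply: diagM => j; rewrite !mxE; case: eqVneq => [->|Dj].
    by rewrite sqrtC0 mulr0.
  by rewrite mulVf // sqrtC_eq0.
have sDe : diag_mx sD *m diag_mx e = diag_mx sD.
  apply: diagM => j; rewrite !mxE; case: eqVneq => [->|Dj]; last by rewrite mulr1.
  by rewrite sqrtC0 mul0r.
have sDsDi : diag_mx sD *m diag_mx sDi = diag_mx e by rewrite -De diag_mxC.
have eUB : diag_mx e *m U *m B = U *m B.
  apply/row_matrixP => j; rewrite -mulmxA row_diag_mul mxE row_mul.
  by case: eqVneq => [/rowUB ->|_]; rewrite ?scaler0 ?scale1r.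
pose G := U ^t* *m diag_mx sD; pose Gi := diag_mx sDi *m U.
have AG : A = G *m G ^t*.
  by rewrite /G trC_mul trmxCK sDR mulmxA -(mulmxA (U ^t*)) DD.
have GiG : Gi *m G = diag_mx e by rewrite /Gi /G mulmxA -(mulmxA (diag_mx sDi)) UU mulmx1.
have GE : G *m diag_mx e = G by rewrite /G -mulmxA sDe.
have GGiB : G *m Gi *m B = B.
  rewrite /G /Gi mulmxA -(mulmxA (U ^t*)) sDsDi -(mulmxA (U ^t*)) -(mulmxA (U ^t*)) eUB.
  by rewrite mulmxA UU' mul1mx.
clearbody G Gi; pose S := Gi *m B *m Gi ^t*.
have SS : S ^t* = S by rewrite /S !trC_mul trmxCK BB !mulmxA.
(* By the Hankel structure row i of B is row j = i + 1 of A; [Gi] inverts G up to the projection e,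
   which G absorbs. *)
have shift (i j : 'I_N.+1) : j = i.+1 :> nat -> row i G *m S = row j G.
  move=> ij; rewrite -row_mul /S !mulmxA GGiB row_mul.
  have -> : row i B = row j A by apply/rowP => k; rewrite !mxE ij addSn.
  rewrite -row_mul AG -mulmxA -trC_mul GiG eR GE //.
have [V [L [VV VV' SE Lr]]] := hermitian_diagonalization SS.
pose y := row 0 G *m V ^t*.
exists (fun j => y 0 j * (y 0 j)^*), (fun j => L 0 j); split => [j|j|k kN].
- exact: mul_conjC_ge0.
(* The node L_j is the value of B at x = u Gi, where A takes a value at most 1, so the two positive
   forms place it between - M and M. *)
- have VS : V *m S = diag_mx L *m V by rewrite SE !mulmxA VV mul1mx.
  pose u := row j V; pose x := u *m Gi.
  have u1 : (u *m u ^t*) 0 0 = 1.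
    transitivity ((V *m V ^t*) j j); last by rewrite VV mxE eqxx.
    by rewrite !mxE; apply: eq_bigr => k _; rewrite !mxE.
  have xB : (x *m B *m x ^t*) 0 0 = L 0 j.
    have -> : x *m B *m x ^t* = u *m S *m u ^t* by rewrite /x trC_mul /S !mulmxA.
    by rewrite -row_mul VS row_diag_mul -scalemxAl entryZ u1 mulr1.
  have xA : (x *m A *m x ^t*) 0 0 <= 1.
    have -> : x *m A *m x ^t* = u *m (diag_mx e *m diag_mx e) *m u ^t*.
      by rewrite -{2}eR -GiG /x AG !trC_mul !mulmxA.
    have -> : diag_mx e *m diag_mx e = diag_mx e.
      by apply: diagM => i; rewrite !mxE -natrM mulnb andbb.
    rewrite diag_form -u1 dotmx_self; apply: ler_sum => i _.
    rewrite [e 0 i]mxE; case: (_ != _); rewrite ?mulr1 // mulr0; exact: mul_conjC_ge0.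
  have MA : M * (x *m A *m x ^t*) 0 0 <= M by rewrite ger_pMr.
  have := psdp x; have := psdm x; rewrite splitp splitm xB subr_ge0 => h1 h2.
  rewrite (le_trans h1 MA) andbT lerNl; apply: le_trans MA.
  by rewrite -subr_ge0 opprK.
(* Row i of G is row 0 shifted i times, and h k is the inner product of rows k and 0. The rows stop
   at N, whence k <= N. *)
- have vk i : (i <= N)%N -> forall j : 'I_N.+1, j = i :> nat ->
      row j G = y *m diag_mx (\row_j L 0 j ^+ i) *m V.
    elim: i => [|i IHi] iN j ji.
      have -> : j = 0 by exact: val_inj.
      have -> : diag_mx (\row_j L 0 j ^+ 0) = 1%:M :> 'M[C]_N.+1.
        by apply/matrixP => a b; rewrite !mxE expr0.
      by rewrite mulmx1 /y -mulmxA VV' mulmx1.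
    have iN' : (i < N.+1)%N by exact: ltnW.
    rewrite -(@shift (Ordinal iN') j) // (IHi (ltnW iN) (Ordinal iN')) //.
    rewrite SE !mulmxA -(mulmxA _ V) VV mulmx1 -(mulmxA y) mulmx_diag.
    by congr (_ *m diag_mx _ *m _); apply/rowP => a; rewrite !mxE exprSr.
  have kN1 : (k < N.+1)%N by [].
  have -> : h k = (row (Ordinal kN1) G *m (row 0 G) ^t*) 0 0.
    have -> : h k = A (Ordinal kN1) 0 by rewrite mxE addn0.
    by rewrite AG !mxE; apply: eq_bigr => j _; rewrite !mxE.
  rewrite (vk k kN (Ordinal kN1)) //.
  have -> : (row 0 G) ^t* = V ^t* *m y ^t*.
    by rewrite /y trC_mul trmxCK mulmxA VV' mul1mx.
  rewrite mulmxA -(mulmxA _ V) VV mulmx1 diag_form.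
  by apply: eq_bigr => j _; rewrite [X in _ * X = _]mxE.
Qed.

End Quadrature.

(** * Quantile functions *)

Lemma expr_lipschitz (R : realFieldType) (M x y : R) n : 0 <= M ->
  - M <= x <= M -> - M <= y <= M -> x <= y ->
  `|y ^+ n - x ^+ n| <= n%:R * M ^+ n.-1 * (y - x).
Proof.
rewrite -!ler_norml => M0 xM yM xy; rewrite subrXX normrM ger0_norm ?subr_ge0 // mulrC.
apply: ler_wpM2r; first by rewrite subr_ge0.
apply: le_trans (ler_norm_sum _ _ _) _.
rewrite -[X in X%:R * _](card_ord n) -sum1_card natr_sum mulr_suml; apply: ler_sum => i _.
rewrite mul1r normrM !normrX.
have -> : M ^+ n.-1 = M ^+ (n.-1 - i) * M ^+ i.
  by rewrite -exprD subnK // -ltnS prednK ?ltn_ord // (leq_ltn_trans _ (ltn_ord i)).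
by apply: ler_pM; rewrite ?exprn_ge0 // lerXn2r ?nnegrE.
Qed.

Section MonotonePower.
Variables (R : realType) (M : R) (f : R -> R) (n : nat).
Hypothesis fnd : {homo f : x y / x <= y}.
Hypothesis fM : forall x, - M <= f x <= M.
Local Notation mu := (@lebesgue_measure R).
Local Notation h := (fun x => f x ^+ n).

Let M0 : 0 <= M.
Proof. by have /andP[h1 h2] := fM 0; lra. Qed.

Lemma bounded_itv_integrable_cst (a b c : R) :
  mu.-integrable `]a, b] (EFin \o (fun=> c)).
Proof.
apply: measurable_bounded_integrable => //=.
  by rewrite lebesgue_measure_itv /=; case: ifP => // _; rewrite -EFinB ltry.
exact: bounded_cst.
Qed.

Lemma monotone_pow_integrable (a b : R) : mu.-integrable `]a, b] (EFin \o h).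
Proof.
apply: measurable_bounded_integrable => //=.
- by rewrite lebesgue_measure_itv /=; case: ifP => // _; rewrite -EFinB ltry.
- by apply: measurable_funX; exact: nondecreasing_measurable.
- exists (M ^+ n); split; first exact: num_real.
  move=> y My x _ /=; rewrite normrX; apply: le_trans (ltW My).
  by rewrite lerXn2r ?nnegrE // ler_norml.
Qed.

Lemma integral_cell (a b c1 c2 : R) : a <= b ->
  (forall x, a < x <= b -> c1 <= f x ^+ n <= c2) ->
  c1 * (b - a) <= \int[mu]_(x in `]a, b]) (f x ^+ n) <= c2 * (b - a).
Proof.
move=> ab hc; have cst c : \int[mu]_(x in `]a, b]) c = c * (b - a).
  rewrite Rintegral_cst //= lebesgue_measure_itv /= lte_fin.
  by case: ltgtP ab => // -> _; rewrite subrr.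
rewrite -!cst; apply/andP; split; apply: le_Rintegral => //;
  try exact: bounded_itv_integrable_cst; try exact: monotone_pow_integrable;
  by move=> x /=; rewrite in_itv /= => /hc/andP[].
Qed.

Lemma integral_split (a b : R) : 0 <= a -> a <= b ->
  \int[mu]_(x in `]0, b]) (f x ^+ n) =
  \int[mu]_(x in `]0, a]) (f x ^+ n) + \int[mu]_(x in `]a, b]) (f x ^+ n).
Proof.
move=> a0 ab; apply/eqP; rewrite addrC -subr_eq; apply/eqP.
by apply: (Rintegral_itvB (monotone_pow_integrable 0 b)); rewrite bnd_simp.
Qed.

Lemma integral_empty (a : R) : \int[mu]_(x in `]a, a]) (f x ^+ n) = 0.
Proof. by rewrite set_itv_ge ?bnd_simp ?ltxx // Rintegral_set0. Qed.

(** On each cell the error is controlled by the Lipschitz constant of the n-th power on [-M, M]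
    times the increment of f. By monotonicity the increments telescope to at most 2M, whatever the
    jumps of f. *)
Lemma riemann_monotone (k : nat) : (0 < k)%N ->
  `|\int[mu]_(x in `]0, 1]) (f x ^+ n) - k%:R^-1 * \sum_(i < k) f (i%:R / k%:R) ^+ n|
    <= k%:R^-1 * (n%:R * M ^+ n.-1 * (2 * M)).
Proof.
move=> k0; have kR : (0 : R) < k%:R by rewrite ltr0n.
set L := n%:R * M ^+ n.-1; have L0 : 0 <= L by rewrite mulr_ge0 // exprn_ge0.
have step j : `|\int[mu]_(x in `]0, j%:R / k%:R]) (f x ^+ n)
    - k%:R^-1 * \sum_(i < j) f (i%:R / k%:R) ^+ n|
    <= k%:R^-1 * (L * (f (j%:R / k%:R) - f 0)).
  elim: j => [|j IHj].
    by rewrite mul0r integral_empty big_ord0 mulr0 subrr normr0 subrr !mulr0.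
  set a := j%:R / k%:R in IHj *; set b := j.+1%:R / k%:R.
  have ba : b - a = k%:R^-1 by rewrite /b /a -mulrBl -natrB // subSnn mul1r.
  have ab : a <= b by rewrite -subr_ge0 ba invr_ge0 ltW.
  have a0 : 0 <= a by rewrite divr_ge0 // ltW.
  rewrite (integral_split a0 ab) big_ord_recr mulrDr.
  have hc x : a < x <= b -> f a ^+ n - L * (f b - f a) <= f x ^+ n <= f a ^+ n + L * (f b - f a).
    move=> /andP[ax xb]; have fax := fnd (ltW ax); have fxb := fnd xb.
    have := expr_lipschitz n M0 (fM a) (fM x) fax; rewrite -/L ler_norml => /andP[e1 e2].
    have : L * (f x - f a) <= L * (f b - f a) by rewrite ler_wpM2l // lerB.
    by lra.
  have := integral_cell ab hc; rewrite ba; set I := \int[mu]_(x in `]a, b]) _.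
  move: IHj; set J := \int[mu]_(x in _) _; set Sg := \sum_(i < j) _.
  rewrite -/a; set ki := k%:R^-1; rewrite !ler_norml => /andP[e1 e2] /andP[e3 e4].
  by apply/andP; split; nra.
have := step k; rewrite divff ?gt_eqF // => /le_trans; apply.
apply: ler_wpM2l; first by rewrite invr_ge0 ltW.
apply: ler_wpM2l => //.
by have /andP[h1 h2] := fM 1; have /andP[h3 h4] := fM 0; lra.
Qed.

End MonotonePower.

(** * Quantile functions of finitely supported measures *)

Section StepQuantile.
Variables (R : realType) (M : R) (s : seq (R * R)).
Hypothesis srt : sorted (fun p p' : R * R => p.1 <= p'.1) s.
Hypothesis bnd : forall p, p \in s -> - M <= p.1 <= M.
Hypothesis wge0 : forall p, p \in s -> 0 <= p.2.
Hypothesis wsum : \sum_(p <- s) p.2 = 1.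
Local Notation mu := (@lebesgue_measure R).

Let p0 : R * R := (0, 0).
Let cumul (i : nat) : R := \sum_(l < i) (nth p0 s l).2.

(** Only the inner breakpoints 1, ..., [size s] - 1 are counted, so the index is valid for every
    real t, and monotonicity and the bound hold on the whole line. *)
Definition step_quantile (t : R) : R :=
  (nth p0 s (count (fun i => (cumul i < t)%R) (iota 1 (size s).-1))).1.

Let size_gt0 : (0 < size s)%N.
Proof.
by case: (s) wsum => //; rewrite big_nil => /esym/eqP; rewrite oner_eq0.
Qed.

Let count_lt t : (count (fun i => (cumul i < t)%R) (iota 1 (size s).-1) < size s)%N.
Proof.
by rewrite -[X in (_ < X)%N](prednK size_gt0) ltnS (leq_trans (count_size _ _)) // size_iota.
Qed.

Lemma step_quantile_nd : {homo step_quantile : x y / x <= y}.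
Proof.
move=> x y xy; rewrite /step_quantile.
have tr : transitive (fun p p' : R * R => p.1 <= p'.1) by move=> ? ? ?; exact: le_trans.
apply: (sorted_leq_nth tr _ p0 srt) => //; try exact: count_lt.
by apply: sub_count => i /= ix; exact: lt_le_trans xy.
Qed.

Lemma step_quantile_bound t : - M <= step_quantile t <= M.
Proof. by apply: bnd; apply: mem_nth; exact: count_lt. Qed.

Let cumul_le i j : (i <= j)%N -> (j <= size s)%N -> cumul i <= cumul j.
Proof.
move=> /subnKC <-; elim: (j - i)%N => [|k IHk]; first by rewrite addn0.
rewrite addnS => ks; apply: le_trans (IHk (ltnW ks)) _.
by rewrite /cumul big_ord_recr /= lerDl; apply: wge0; exact: mem_nth.
Qed.

Let cumul_ge0 i : (i <= size s)%N -> 0 <= cumul i.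
Proof. by move=> h; have := @cumul_le 0%N i (leq0n _) h; rewrite /cumul big_ord0. Qed.

Lemma step_quantileE j t : (j < size s)%N -> cumul j < t <= cumul j.+1 ->
  step_quantile t = (nth p0 s j).1.
Proof.
move=> js /andP[jt tj]; rewrite /step_quantile; congr (nth p0 s _).1.
have js' : (j <= (size s).-1)%N by rewrite -ltnS prednK.
rewrite -(subnKC js') iotaD count_cat.
have -> : count (fun i => (cumul i < t)%R) (iota 1 j) = j.
  rewrite -[RHS](size_iota 1 j); apply/eqP; rewrite -all_count; apply/allP => i.
  rewrite mem_iota add1n ltnS => /andP[_ ij]; apply: le_lt_trans jt.
  by apply: cumul_le => //; exact: ltnW.
rewrite -[RHS]addn0; congr addn; apply/eqP; rewrite -leqn0 leqNgt -has_count.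
apply/hasPn => i; rewrite mem_iota add1n => /andP[ji i2]; rewrite -leNgt.
apply: le_trans tj _; apply: cumul_le => //.
move: i2; rewrite addSn subnKC // prednK // => i2; exact: ltnW.
Qed.

Lemma integral_step_quantile n :
  \int[mu]_(x in `]0, 1]) (step_quantile x ^+ n) = \sum_(p <- s) p.2 * p.1 ^+ n.
Proof.
have step j : (j <= size s)%N -> \int[mu]_(x in `]0, cumul j]) (step_quantile x ^+ n) =
    \sum_(l < j) (nth p0 s l).2 * (nth p0 s l).1 ^+ n.
  elim: j => [|j IHj] js; first by rewrite /cumul !big_ord0 integral_empty.
  have jj := cumul_le (leqnSn j) js.
  rewrite (integral_split n step_quantile_nd step_quantile_bound (cumul_ge0 (ltnW js)) jj).
  rewrite IHj ?(ltnW js) // big_ord_recr /=; congr (_ + _).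
  set c := (nth p0 s j).1 ^+ n.
  have hc x : cumul j < x <= cumul j.+1 -> c <= step_quantile x ^+ n <= c.
    by move=> /(step_quantileE js) ->; rewrite lexx.
  have := integral_cell step_quantile_nd step_quantile_bound jj hc.
  rewrite -eq_le => /eqP <-; rewrite mulrC; congr (_ * _).
  by rewrite /cumul big_ord_recr /= addrAC subrr add0r.
have cs : cumul (size s) = 1 by rewrite /cumul -wsum (big_nth p0) big_mkord.
by rewrite -{1}cs step // (big_nth p0) big_mkord.
Qed.

End StepQuantile.

(** * The moment problem *)

Section MomentProblem.
Variables (R : realType) (m : nat -> R) (M : R).
Local Notation C := R[i].
Hypothesis M0 : 0 < M.
Hypothesis m0 : m 0%N = 1.
Hypothesis hp : forall N (c : 'I_N.+1 -> C),
  0 <= \sum_i \sum_j c i * (c j)^* * (M * m (i + j)%N + m (i + j).+1)%:C.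
Hypothesis hm : forall N (c : 'I_N.+1 -> C),
  0 <= \sum_i \sum_j c i * (c j)^* * (M * m (i + j)%N - m (i + j).+1)%:C.
Local Notation mu := (@lebesgue_measure R).

Definition riemann_rate n : R := n%:R * M ^+ n.-1 * (2 * M).

Definition riemann_sum (f : R -> R) n k : R :=
  k%:R^-1 * \sum_(i < k) f (i%:R / k%:R) ^+ n.

Lemma quadrature_real N : exists s : seq (R * R),
  [/\ forall p, p \in s -> - M <= p.1 <= M, forall p, p \in s -> 0 <= p.2 &
      forall k, (k <= N)%N -> \sum_(p <- s) p.2 * p.1 ^+ k = m k].
Proof.
have form (T : nat -> R) (x : 'rV[C]_N.+1) (Q : 'M[C]_N.+1) :
    (forall i j : 'I_N.+1, Q i j = (T (i + j)%N)%:C) ->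
    (x *m Q *m map_mx Num.conj (x^T)) 0 0 = \sum_i \sum_j x 0 i * (x 0 j)^* * (T (i + j)%N)%:C.
  move=> QT; rewrite mxE exchange_big; apply: eq_bigr => j _ /=.
  rewrite !mxE mulr_suml; apply: eq_bigr => i _.
  by rewrite QT mulrAC.
have MC : 0 < M%:C :> C by rewrite ltcR.
have := @hankel_quadrature _ N (fun k => (m k)%:C) M%:C MC (fun k => conjCR (m k)).
move=> /= [x|x|w [l [w0 lM hk]]].
- rewrite (form (fun k => M * m k + m k.+1)) => [|i j]; first exact: hp.
  by rewrite !mxE rmorphD rmorphM.
- rewrite (form (fun k => M * m k - m k.+1)) => [|i j]; first exact: hm.
  by rewrite !mxE rmorphB rmorphM.
have lR j : l j = (complex.Re (l j))%:C.
  have /andP[+ _] := lM j; rewrite -rmorphN; case: (l j) => a b.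
  by rewrite lecE /= => /andP[/eqP -> _].
have wR j : w j = (complex.Re (w j))%:C.
  by have := w0 j; case: (w j) => a b; rewrite lecE /= => /andP[/eqP -> _].
exists [seq (complex.Re (l j), complex.Re (w j)) | j <- enum 'I_N.+1]; split.
- move=> _ /mapP[j _ ->] /=.
  by have := lM j; rewrite lR -rmorphN !lecR.
- by move=> _ /mapP[j _ ->] /=; have := w0 j; rewrite wR lecR.
- move=> k kN; apply: (@complexI R); rewrite hk // big_map big_enum rmorph_sum /=.
  by apply: eq_bigr => j _; rewrite rmorphM rmorphXn /= -!lR -!wR.
Qed.

(** The node bound M is common to all N, so the error rate does not depend on N and passes to the
    limit. *)
Lemma riemann_quantile N : exists f : R -> R,
  [/\ {homo f : x y / x <= y}, forall x, - M <= f x <= M &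
      forall n k, (n <= N)%N -> (0 < k)%N ->
        `|m n - riemann_sum f n k| <= k%:R^-1 * riemann_rate n].
Proof.
have [s0 [bnd0 wge0 mE0]] := quadrature_real N.
pose le1 := fun p p' : R * R => p.1 <= p'.1.
pose s := sort le1 s0; have ps : perm_eq s s0 by rewrite perm_sort.
have srt : sorted le1 s by apply: sort_sorted => p p'; exact: le_total.
have bnd p : p \in s -> - M <= p.1 <= M by rewrite mem_sort; exact: bnd0.
have wge p : p \in s -> 0 <= p.2 by rewrite mem_sort; exact: wge0.
have mE k : (k <= N)%N -> \sum_(p <- s) p.2 * p.1 ^+ k = m k.
  by move=> kN; rewrite (perm_big _ ps) mE0.
have wsum : \sum_(p <- s) p.2 = 1.
  by rewrite -m0 -(mE 0%N) //; apply: eq_bigr => p _; rewrite expr0 mulr1.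
have nd := step_quantile_nd srt wsum; have bd := step_quantile_bound bnd wsum.
exists (step_quantile s); split => // n k nN k0.
rewrite -mE // -(integral_step_quantile srt bnd wge wsum).
exact: (riemann_monotone n nd bd k0).
Qed.

Lemma bounded_moment_problem : exists nu : probability (measurableTypeR R) R,
  nu (~` `[- M, M]) = 0%E /\ forall n, \int[nu]_x (x ^+ n) = m n.
Proof.
have [f_ fP] := choice riemann_quantile.
have [G [GU Ginf]] := @ultraFilterLemma nat \oo _.
(* In the compact interval the images of the ultrafilter cluster, and a cluster point of an
   ultrafilter is a limit. One and the same [G] serves all t. *)
have limf t : exists p : R, (- M <= p <= M) /\ f_ ^~ t @ G --> p.
  have GA : (f_ ^~ t @ G) `[- M, M]%classic.
    change (G [set N | `[- M, M]%classic (f_ N t)]).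
    by apply: filterE => N /=; rewrite in_itv /=; have [_ + _] := fP N; exact.
  have [p [Mp clp]] := @segment_compact R (- M) M (f_ ^~ t @ G) _ GA.
  exists p; split; first by move: Mp; rewrite /= in_itv.
  move=> B pB; have [//|nB] := in_ultra_setVsetC (f_ ^~ t @^-1` B) GU.
  have /(_ nB pB)[y [/= ny By]] := clp (~` B) B.
  by case: ny.
have [g gP] := choice limf.
have gM x : - M <= g x <= M by case: (gP x).
have gnd : {homo g : x y / x <= y}.
  move=> x y xy; have [_ cx] := gP x; have [_ cy] := gP y.
  rewrite -subr_ge0.
  refine (@closed_cvg _ _ G _ (fun N => f_ N y - f_ N x) (fun z : R => 0 <= z) _ _ (g y - g x) _).
  - exact: closed_ge.
  - by apply: filterE => N /=; rewrite subr_ge0; have [+ _ _] := fP N; exact.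
  - exact: cvgB.
have gR n k : (0 < k)%N -> `|m n - riemann_sum g n k| <= k%:R^-1 * riemann_rate n.
  move=> k0.
  refine (@closed_cvg _ _ G _ (fun N => `|m n - riemann_sum (f_ N) n k|)
    (fun z : R => z <= k%:R^-1 * riemann_rate n) _ _ `|m n - riemann_sum g n k| _).
  - exact: closed_le.
  (* The moment of order n is matched as soon as N >= n, and [G] contains all such tails. *)
  - apply: Ginf; exists n => // N /= nN.
    by have [_ _] := fP N; exact.
  have sumc j : (fun N => \sum_(i < j) f_ N (i%:R / k%:R) ^+ n) @ G -->
      \sum_(i < j) g (i%:R / k%:R) ^+ n.
    elim: j => [|j IHj].
      by rewrite big_ord0; under eq_cvg do rewrite big_ord0; exact: cvg_cst.
    rewrite big_ord_recr; under eq_cvg do rewrite big_ord_recr.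
    apply: cvgD; first exact: IHj.
    apply: (@continuous_cvg _ _ _ G _ (fun N => f_ N (j%:R / k%:R)) (fun z => z ^+ n)).
      exact: exprn_continuous.
    by case: (gP (j%:R / k%:R)).
  apply: cvg_norm; apply: cvgB; first exact: cvg_cst.
  by apply: cvgM; [exact: cvg_cst|exact: sumc].
(* The integral and [m n] are both within [riemann_rate n] / k of the same Riemann sum; k is taken
   large enough to make each error at most e / 2. *)
have mom n : \int[mu]_(x in `]0, 1]) (g x ^+ n) = m n.
  apply/eqP; rewrite -subr_eq0 -normr_eq0 eq_le normr_ge0 andbT.
  apply/(@ler_addgt0Pl R) => e e0; rewrite addr0.
  have r0 : 0 <= riemann_rate n by rewrite !mulr_ge0 ?exprn_ge0 // ltW.
  have [k0 k0e] : exists k : nat, 2 * riemann_rate n < k.+1%:R * e.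
    exists (Num.truncn (2 * riemann_rate n / e)); rewrite -ltr_pdivrMr //.
    by have /andP[] := truncn_itv (divr_ge0 (mulr_ge0 (ler0n _ 2) r0) (ltW e0)).
  have h1 := riemann_monotone n gnd gM (ltn0Sn k0).
  have h2 := gR n k0.+1 (ltn0Sn k0).
  have {}h1 : `|\int[mu]_(x in `]0, 1]) (g x ^+ n) - riemann_sum g n k0.+1| <= k0.+1%:R^-1 * riemann_rate n by [].
  have h3 : k0.+1%:R^-1 * riemann_rate n <= e / 2.
    by rewrite mulrC ler_pdivrMr ?ltr0n //; nra.
  move: h1 h2; move: (k0.+1%:R^-1 * riemann_rate n) h3 (riemann_sum g n k0.+1) => K h3 S.
  move: (\int[mu]_(x in _) _) => I; rewrite !ler_norml => /andP[a1 a2] /andP[b1 b2].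
  by apply/andP; split; lra.
have mg : @measurable_fun _ _ (measurableTypeR R) (measurableTypeR R) setT g.
  exact: nondecreasing_measurable.
(* The measure sought is the law of g at a uniform random point of [0, 1]. *)
pose X : {mfun measurableTypeR R >-> measurableTypeR R} :=
  HB.pack (g : measurableTypeR R -> measurableTypeR R) (isMeasurableFun.Build _ _ (measurableTypeR R) (measurableTypeR R) g mg).
pose P : probability (measurableTypeR R) R := uniform_prob (@ltr01 R).
have mpow n : measurable_fun [set: measurableTypeR R] (fun x : measurableTypeR R => g x ^+ n : R).
  exact: measurable_funX.
have bpow n x : `|g x ^+ n| <= M ^+ n.
  rewrite normrX; apply: lerXn2r; rewrite ?nnegrE ?normr_ge0 //; first exact: ltW.
  by rewrite ler_norml.
have iP n : P.-integrable [set: measurableTypeR R] (EFin \o (fun x => g x ^+ n)).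
  apply: measurable_bounded_integrable => //=.
    by rewrite probability_setT ltry.
  exists (M ^+ n); split; first exact: num_real.
  by move=> y My x _ /=; apply: le_trans (ltW My).
have imu n : mu.-integrable `[0, 1] (EFin \o (fun x => g x ^+ n)).
  apply: measurable_bounded_integrable => //=.
  - by rewrite lebesgue_measure_itv /= lte_fin ltr01 -EFinB ltry.
  - exact: measurable_funTS.
  - exists (M ^+ n); split; first exact: num_real.
    by move=> y My x _ /=; apply: le_trans (ltW My).
have uni n : \int[P]_x (g x ^+ n) = \int[mu]_(x in `[0, 1]) (g x ^+ n).
  (* [integral_uniform] is applied to a nonnegative integrand, hence the shift by M^n, which is
     cancelled afterwards. *)
  have h : \int[P]_x (g x ^+ n + M ^+ n) = \int[mu]_(x in `[0, 1]) (g x ^+ n + M ^+ n).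
    rewrite /Rintegral integral_uniform.
    - by rewrite subr0 invr1 mul1e.
    - by apply/measurable_EFinP; apply: measurable_funD.
    - move=> x; rewrite lee_fin; have := bpow n x; rewrite ler_norml => /andP[+ _].
      by rewrite -lerBlDr sub0r.
  have cP : P.-integrable [set: measurableTypeR R] (EFin \o (fun=> M ^+ n)).
    apply: measurable_bounded_integrable => //=; last exact: bounded_cst.
    by rewrite probability_setT ltry.
  have cmu : mu.-integrable `[0, 1] (EFin \o (fun=> M ^+ n)).
    apply: measurable_bounded_integrable => //=; last exact: bounded_cst.
    by rewrite lebesgue_measure_itv /= lte_fin ltr01 -EFinB ltry.
  move: h; rewrite !RintegralD // !Rintegral_cst //= probability_setT.
  by rewrite lebesgue_measure_itv /= lte_fin ltr01 /= subr0 => /addIr.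
exists (distribution P X); split.
  rewrite /distribution /pushforward /=.
  rewrite (_ : _ @^-1` _ = set0) ?measure0 //.
  by apply/seteqP; split => // x /=; apply; rewrite in_itv /=; exact: gM.
move=> n; rewrite -mom Rintegral_itv_obnd_cbnd; last exact: monotone_pow_integrable.
rewrite -uni /Rintegral integral_distribution //; last exact: iP.
by apply/measurable_EFinP; exact: measurable_funX.
Qed.

End MomentProblem.

(** * Distribution of the operator *)

Section Moments.
Variables (R : realType) (d : nat) (q : R).
Hypotheses (hd : (0 < d)%N) (hq : -1 < q < 1).
Local Notation C := R[i].
Local Notation V := (qvec R d).
Local Notation F := (@qfock R d q).
Local Notation T := (Top d q).
Local Notation vac := (@vacuum R d).

(** Order 0 is set apart: the sum defining [Qtilde] is empty for n = 0, while a probability measure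
    has mass 1. *)
Definition moment n : R := if n is 0%N then 1 else Qtilde n d%:R q.

Let FT x : F x -> F (T x).
Proof. by case: (fock_bounded_Top d hq) => + _ _; apply. Qed.

Let Fiter n : F (iter n T vac).
Proof. by elim: n => [|n IHn]; [exact: qfock_vacuum|exact: FT]. Qed.

(** Selfadjointness moves every [T] to the left argument, so the Gram matrix of the iterates is a
    Hankel matrix. *)
Lemma qinner_iter_Top i j : qinner q (iter i T vac) (iter j T vac) = (moment (i + j))%:C.
Proof.
elim: j i => [|j IHj] i.
  rewrite addn0; case: i => [|i]; first by rewrite qinner_vacuum.
  exact: (vacuum_moment_Qtilde hq hd (ltn0Sn i)).
by rewrite addnS -addSn -IHj /= selfadjoint_Top.
Qed.

Let comb N (c : 'I_N.+1 -> C) : V := \sum_i c i *: iter i T vac.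

Let Fcomb N (c : 'I_N.+1 -> C) : F (comb c).
Proof. by apply: qfock_sum => // i _; apply: qfockZ. Qed.

Let Top_comb N (c : 'I_N.+1 -> C) : T (comb c) = \sum_i c i *: iter i.+1 T vac.
Proof.
have [_ lT _] := fock_bounded_Top d hq.
have TD x y : F x -> F y -> T (x + y) = T x + T y.
  by move=> Fx Fy; rewrite -[x]scale1r lT // !scale1r.
have T0 : T 0 = 0.
  have F0 := @qfock0 R d q hq.
  by apply: (addrI (T 0)); rewrite -TD // !addr0.
have TZ a x : F x -> T (a *: x) = a *: T x.
  by move=> Fx; rewrite -[a *: x]addr0 lT ?T0 ?addr0 //; exact: qfock0.
suff [] : F (comb c) /\ T (comb c) = \sum_i c i *: iter i.+1 T vac by [].
rewrite /comb; elim/big_ind2: _ => [|x x' y y' [Fx Ex] [Fy Ey]|i _].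
- by split; [exact: qfock0|].
- by split; [exact: qfockD|rewrite TD // Ex Ey].
- by split; [exact: qfockZ|rewrite TZ].
Qed.

(** For x = [comb c], the cases u = 0 and u = 1 compute <x, x> and <T x, x>. *)
Let inner_comb N (c : 'I_N.+1 -> C) (u : nat) :
  qinner q (\sum_i c i *: iter (u + i) T vac) (comb c) =
  \sum_i \sum_j c i * (c j)^* * (moment (u + (i + j)))%:C.
Proof.
have Fu i : F (c i *: iter (u + i) T vac) by apply: qfockZ.
rewrite qinner_lsum //; apply: eq_bigr => i _.
rewrite qinner_rsum // => [|j _]; last exact: qfockZ.
apply: eq_bigr => j _; have Fj : F (c j *: iter j T vac) by exact: qfockZ.
by rewrite qinner_lZ // qinner_rZ // qinner_iter_Top addnA mulrA.
Qed.

Lemma normsq_expand (e : R) (x y : V) : F x -> F y ->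
  normsq q (e%:C *: x + y) = e ^+ 2 * normsq q x + 2 * e * complex.Re (qinner q y x) + normsq q y.
Proof.
move=> Fx Fy; have Fex : F (e%:C *: x) by exact: qfockZ.
have Fxy := qfockD hq Fex Fy.
have -> : normsq q (e%:C *: x + y) = complex.Re (qinner q (e%:C *: x + y) (e%:C *: x + y)).
  by rewrite qinner_normsq.
rewrite qinnerDZ // !qinner_rD // !qinner_rZ // !qinner_normsq // conjCR mulrDr !ReD !ReZ.
rewrite -[complex.Re (normsq q x)%:C]/(normsq q x) -[complex.Re (normsq q y)%:C]/(normsq q y).
by rewrite -(qinner_sym hq Fy Fx) Re_conjC; ring.
Qed.

(** Expand the square norms of T x + M x and T x - M x. The choice M = K + 1 is positive and
    satisfies K <= M^2, which spares a square root. *)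
Lemma Top_form_bound : exists2 M : R, 0 < M & forall x, F x ->
  exists2 a : R, qinner q (T x) x = a%:C & - (M * normsq q x) <= a <= M * normsq q x.
Proof.
have [_ _ [K K0 bT]] := fock_bounded_Top d hq.
exists (K + 1) => [|x Fx]; first by rewrite ltr_wpDl.
have FTx := FT Fx; exists (complex.Re (qinner q (T x) x)).
  have /(congr1 (@complex.Im R)) : (qinner q (T x) x)^* = qinner q (T x) x.
    by rewrite qinner_sym // selfadjoint_Top.
  rewrite Im_conjC; case: (qinner q (T x) x) => a b /= bb.
  by have -> : b = 0 by lra.
have [h1 h2] : 0 <= normsq q ((K + 1)%:C *: x + T x) /\ 0 <= normsq q ((- (K + 1))%:C *: x + T x).
  by split; apply: normsq_ge0 => //; apply: qfockD => //; exact: qfockZ.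
rewrite !normsq_expand // in h1 h2; have := bT x Fx; have := normsq_ge0 hq Fx.
move: (complex.Re _) (normsq q x) (normsq q (T x)) h1 h2 => a u v h1 h2 u0 vK.
have vu : v <= (K + 1) ^+ 2 * u by apply: le_trans vK _; apply: ler_wpM2r => //; nra.
have K1 : 0 < 2 * (K + 1) by lra.
by apply/andP; split; rewrite -(ler_pM2l K1); nra.
Qed.

Lemma moment_positivity : exists2 M : R, 0 < M &
  forall N (c : 'I_N.+1 -> C),
    0 <= \sum_i \sum_j c i * (c j)^* * (M * moment (i + j)%N + moment (i + j).+1)%:C /\
    0 <= \sum_i \sum_j c i * (c j)^* * (M * moment (i + j)%N - moment (i + j).+1)%:C.
Proof.
have [M M0 bM] := Top_form_bound; exists M => // N c.
have [a aE /andP[a1 a2]] := bM _ (@Fcomb N c).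
have E0 := inner_comb c 0; rewrite -/(comb c) qinner_normsq // in E0.
have E1 := inner_comb c 1; rewrite -Top_comb aE in E1.
have split_sum (e : R) : \sum_i \sum_j c i * (c j)^* * (M * moment (i + j)%N + e * moment (i + j).+1)%:C =
    (M * normsq q (comb c) + e * a)%:C.
  have -> : (M * normsq q (comb c) + e * a)%:C =
      M%:C * (normsq q (comb c))%:C + e%:C * a%:C by rewrite rmorphD !rmorphM.
  rewrite E0 E1 !mulr_sumr -big_split; apply: eq_bigr => i _ /=.
  rewrite !mulr_sumr -big_split; apply: eq_bigr => j _ /=.
  by rewrite add0n add1n rmorphD !rmorphM; ring.
split.
  have := split_sum 1; rewrite mul1r.
  under eq_bigr do under eq_bigr do rewrite mul1r.
  by move=> ->; rewrite lecR; lra.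
have := split_sum (-1); rewrite mulN1r.
under eq_bigr do under eq_bigr do rewrite mulN1r.
by move=> ->; rewrite lecR; lra.
Qed.

End Moments.

Theorem corollary1p5 (R : realType) (d : nat) (q : R)
    (hd : (0 < d)%N) (hq : -1 < q < 1) :
  exists nu : probability (measurableTypeR R) R,
    [/\ compactly_supported nu,
        forall n : nat, (0 < n)%N ->
          (\int[nu]_x (x ^+ n)) = Qtilde n d%:R q,
        bounded_operator q (Top d q),
        selfadjoint q (Top d q) &
        is_distribution (vacuum_state q) (Top d q) nu].
Proof.
have [M M0 pos] := moment_positivity hd hq.
have [nu [nuM mom]] := @bounded_moment_problem R (moment d q) M M0 erefl
  (fun N c => (pos N c).1) (fun N c => (pos N c).2).
have cs : compactly_supported nu by exists `[- M, M]%classic => //; exact: segment_compact.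
have momQ n : (0 < n)%N -> \int[nu]_x (x ^+ n) = Qtilde n d%:R q.
  by case: n => // n _; rewrite mom.
exists nu; split => //.
- by apply: (fock_bounded_operator hq); exact: fock_bounded_Top.
- exact: selfadjoint_Top.
- by split => // n n0; rewrite vacuum_moment_Qtilde // momQ.
Qed.
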